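(* Let $\Gamma$ be a finitely generated non-elementary group hyperbolic relative to finitely generated infinite virtually nilpotent subgroups $H_1,\dots,H_l$, and let $X$ be its cusped graph. There is a reversible Markov chain $(X,P,m)$, with Green metric $\rho_G$, such that for a process $\{Y_i\}_{i\in\mathbb N_0}$ corresponding to $(X,P,m)$ the following limits exist and are constants for $\mathbb P_m$-a.e. trajectory $\omega$: $$\lim_{n\to\infty}\frac{\rho_X(Y_0(\omega),Y_n(\omega))}{n}=:l,\qquad \lim_{n\to\infty}\frac{\rho_G(Y_0(\omega),Y_n(\omega))}{n}=:l_G,\qquad \lim_{n\to\infty}\frac{-\log p^{(n)}(Y_0(\omega),Y_n(\omega))}{n}=:h.$$
   Context: Cusped graph. $\mathbb N=\{1,2,\dots\}$, $\mathbb N_0=\mathbb N\cup\{0\}$. Let $S$ be a finite symmetric generating set of $\Gamma$ such that $S\cap H_i$ generates $H_i$ for each $i$, $d$ the word metric of $\mathrm{Cay}(\Gamma,S)$, and fix $a>1$. The cusped graph $X$ has vertex set $(\Gamma\times\{0\})\sqcup\bigsqcup_{i=1}^l\left(\bigcup_{g\in\Gamma}gH_i\times\mathbb N\right)$ and edges: (i) $((g,0),(g',0))$ when $(g,g')$ is an edge of $\mathrm{Cay}(\Gamma,S)$; (ii) for $n\in\mathbb N_0$, $g\in\Gamma$, $h,h'\in H_i$: $((gh,n),(gh',n))$ when $d(h,h')\le a^n$; (iii) for $n\in\mathbb N_0$, $g\in\Gamma$, $h,h'\in H_i$: $((gh,n),(gh',n+1))$ when $d(h,h')\le a^{n+1}$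 (vertices of positive depth taken in the copy indexed by $i$, vertices of depth $0$ in $\Gamma\times\{0\}$). $\rho_X$ is the graph metric and $\Gamma$ acts by $g\cdot(g',n)=(gg',n)$. Reversible Markov chain. $(X,P,m)$ is given by an irreducible transition matrix $P=(p(x,y))$ on the vertices of $X$ with $p(gx,gy)=p(x,y)$ and a function $m:X\to(0,\infty)$ with $m(gx)=m(x)$ and $m(x)p(x,y)=m(y)p(y,x)$ for all $x,y\in X$, $g\in\Gamma$. $p^{(n)}$ denotes $n$-step transition probabilities. $\mathbb P_x$ is the law on trajectories of the chain started at $x$, $\mathbb P_m=\sum_{x\in X}m(x)\mathbb P_x$, and $Y_i$ is the position at time $i$. Green metric. The chain is transient with Green function $G(x,y)=\sum_{n\ge0}p^{(n)}(x,y)$, and is required to be such that there is $C'\ge1$ with $\frac{G(x,z)}{C'm(z)}\ge\frac{G(x,y)}{C'm(y)}\cdot\frac{G(y,z)}{C'm(z)}$ and $\frac{G(x,y)}{C'm(y)}<e^{-1}$ for all $x,y,z\in X$ with $y\notin\{x,z\}$. Let $C$ be the infimum of such $C'$. Then $\rho_G(x,y)=-\log\frac{G(x,y)}{C\,m(y)}$ for $x\ne y$, and $\rho_G(x,x)=0$; this is a $\Gamma$-invariant metric on the vertices of $X$. *)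

(* Defs.v *)
From HB Require Import structures.
From mathcomp Require Import all_boot all_order all_algebra.
From mathcomp Require Import all_classical all_reals all_analysis.

Set Implicit Arguments.
Unset Strict Implicit.
Unset Printing Implicit Defensive.

Import Order.TTheory GRing.Theory Num.Theory.
Import numFieldNormedType.Exports.

Local Open Scope classical_set_scope.
Local Open Scope ring_scope.

Section Groups.
Variable G : groupType.
Implicit Types (A B H K S : set G).

Definition is_subgroup H : Prop :=
  [/\ H 1%g, (forall x y, H x -> H y -> H (x * y)%g)
    & (forall x, H x -> H (x^-1)%g)].

Definition generated A : set G :=
  [set g | forall K, is_subgroup K -> A `<=` K -> K g].

Definition finitely_generated H : Prop :=
  exists2 A, finite_set A & generated A = H.

Definition finite_index_in K H : Prop :=
  [/\ is_subgroup K, K `<=` H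
    & exists2 F : set G, finite_set F
      & forall h, H h -> exists2 f, F f & K (f^-1 * h)%g].

Fixpoint lower_central H (n : nat) : set G :=
  if n is n'.+1 then
    generated [set z | exists x y,
      [/\ lower_central H n' x, H y & z = commg x y]]
  else H.

Definition nilpotent_subgroup H : Prop :=
  is_subgroup H /\ exists n, lower_central H n `<=` [set 1%g].

Definition virtually_nilpotent H : Prop :=
  exists2 K, finite_index_in K H & nilpotent_subgroup K.

(* Finite groups are virtually cyclic. *)
Definition virtually_cyclic H : Prop :=
  exists2 K, finite_index_in K H & exists g, generated [set g] = K.

Definition symmetric_set S : Prop := forall s, S s -> S (s^-1)%g.

End Groups.

Section Graphs.
Variables (V : Type) (E : V -> V -> Prop).

Fixpoint walk (n : nat) (x y : V) : Prop :=
  if n is n'.+1 then exists2 z, E x z & walk n' z y else x = y.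

(* Least length of a walk; the junk value 0 is taken only on pairs of vertices
   lying in different components. *)
Definition graph_dist (x y : V) : nat :=
  match pselect (exists n, `[< walk n x y >]) with
  | left ex => ex_minn ex
  | right _ => 0%N
  end.

End Graphs.

Section Hyperbolic.
Variables (R : realType) (V : Type) (d : V -> V -> R).

Definition gromov_product (w x y : V) : R := (d x w + d y w - d x y) / 2.

Definition gromov_hyperbolic : Prop :=
  exists delta : R, forall x y z w : V,
    Num.min (gromov_product w x y) (gromov_product w y z) - delta
      <= gromov_product w x z.

End Hyperbolic.

Section CuspedGraph.
Variables (R : realType) (G : groupType) (l : nat) (H : 'I_l -> set G).
Variables (S : set G) (a : R).

Definition cayley_edge (g g' : G) : Prop := S (g^-1 * g')%g.

Definition word_dist (g g' : G) : nat := graph_dist cayley_edge g g'.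

(* inl g is (g,0) and inr (i,g,k) is the vertex (g,k.+1) of the i-th copy; the
   cosets of H i partition G, so each positive depth contributes one copy of G
   for every i. *)
Definition cusped : choiceType := (G + 'I_l * G * nat)%type.

Definition vertex (i : 'I_l) (g : G) (n : nat) : cusped :=
  if n is k.+1 then inr (i, g, k) else inl g.

Inductive cusped_arc : cusped -> cusped -> Prop :=
| arc_cayley g g' : cayley_edge g g' -> cusped_arc (inl g) (inl g')
| arc_horizontal i g h h' n : H i h -> H i h' ->
    (word_dist h h')%:R <= a ^+ n ->
    cusped_arc (vertex i (g * h)%g n) (vertex i (g * h')%g n)
| arc_vertical i g h h' n : H i h -> H i h' ->
    (word_dist h h')%:R <= a ^+ n.+1 ->
    cusped_arc (vertex i (g * h)%g n) (vertex i (g * h')%g n.+1).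

Definition cusped_edge (x y : cusped) : Prop :=
  cusped_arc x y \/ cusped_arc y x.

Definition rho_X (x y : cusped) : R := (graph_dist cusped_edge x y)%:R.

Definition cusped_act (g : G) (x : cusped) : cusped :=
  match x with
  | inl g' => inl (g * g')%g
  | inr (i, g', k) => inr (i, (g * g')%g, k)
  end.

Definition cusped_data : Prop :=
  [/\ finite_set S, symmetric_set S, generated S = setT,
      (forall i, generated (S `&` H i) = H i)
    & 1 < a].

End CuspedGraph.

(* Groves--Manning definition: some cusped graph of (G, H) is Gromov
   hyperbolic; equivalently all of them are. *)
Definition relatively_hyperbolic (R : realType) (G : groupType) (l : nat)
    (H : 'I_l -> set G) : Prop :=
  exists (S : set G) (a : R),
    cusped_data H S a /\ gromov_hyperbolic (rho_X H S a).

Definition non_elementary (G : groupType) (l : nat) (H : 'I_l -> set G) : Prop :=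
  ~ virtually_cyclic [set: G] /\ forall i, H i <> [set: G].

Section MarkovChain.
Variables (R : realType) (X : choiceType) (p : X -> X -> R) (m : X -> R).

Fixpoint nstep (n : nat) (x y : X) : \bar R :=
  if n is n'.+1 then (\esum_(z in [set: X]) ((p x z)%:E * nstep n' z y))%E
  else ((x == y)%:R)%:E.

(* act g ranges over the transformations of X by the elements of the group. *)
Definition reversible_chain (G : Type) (act : G -> X -> X) : Prop :=
  [/\ (forall x y, 0 <= p x y),
      (forall x, (\esum_(y in [set: X]) (p x y)%:E = 1)%E),
      (forall x y, exists n, (0 < nstep n x y)%E),
      (forall g x y, p (act g x) (act g y) = p x y)
    & [/\ (forall x, 0 < m x), (forall g x, m (act g x) = m x)
        & (forall x y, m x * p x y = m y * p y x)]].

Definition green (x y : X) : \bar R := (\sum_(0 <= n <oo) nstep n x y)%E.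

Definition transient : Prop := forall x y, (green x y < +oo)%E.

Definition green_fin (x y : X) : R := fine (green x y).

Definition green_constants : set R :=
  [set c | 1 <= c /\ forall x y z, y != x -> y != z ->
     (green_fin x y / (c * m y)) * (green_fin y z / (c * m z))
       <= green_fin x z / (c * m z)
     /\ green_fin x y / (c * m y) < expR (-1)].

Definition has_green_metric : Prop := transient /\ green_constants !=set0.

Definition rho_G (x y : X) : R :=
  if x == y then 0
  else - ln (green_fin x y / (inf green_constants * m y)).

(* Under P x the sequence (Y n) is a version of the chain started at x. *)
Definition markov_process (d : measure_display) (Omega : measurableType d)
    (P : X -> probability Omega R) (Y : nat -> Omega -> X) : Prop :=
  (forall n x, measurable (Y n @^-1` [set x])) /\
  (forall x n (s : nat -> X),
     P x [set w | forall k, (k <= n)%N -> Y k w = s k]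
     = ((x == s 0%N)%:R * \prod_(k < n) p (s k) (s k.+1))%:E).

Definition law_m (d : measure_display) (Omega : measurableType d)
    (P : X -> probability Omega R) (A : set Omega) : \bar R :=
  (\esum_(x in [set: X]) ((m x)%:E * P x A))%E.

End MarkovChain.

(* Main.v *)
Require Import Defs.
From HB Require Import structures.
From mathcomp Require Import all_boot all_order all_algebra.
From mathcomp Require Import all_classical all_reals all_analysis.
From mathcomp Require Import measurable_realfun.
From mathcomp Require Import zify ring lra.

(* Identify the vertices of X with Gamma x Sigma, where Sigma is the set of levels.
   The chain is p(x, y) = mu(base(x)^-1 base(y)) nu(level(y)), with nu a strictly
   positive probability on Sigma that decays exponentially with the depth, and mu the
   mixture with weights proportional to 8^-k of the uniform measures on the balls of
   radius D 4^k.  Since Gamma is not virtually cyclic its growth is at least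
   quadratic: cosets of an infinite cyclic subgroup of infinite index, or, when Gamma
   is torsion, Morse--Hedlund applied to shortlex-minimal words.  So these balls have
   at least 16^k / D elements and the walk using only the first K kernels survives for
   a time of order 8^K, which bounds the Green function by a convergent series; on the
   other hand, as 4 < 8, mu has a finite first moment.
   The increments of the chain are independent and identically distributed, so each of
   the three quantities is, up to an error controlled by the depth of the last vertex,
   a subadditive functional on a Bernoulli shift, and Kingman's theorem gives its
   almost sure linear growth with a deterministic rate. *)

Set Implicit Arguments.
Unset Strict Implicit.
Unset Printing Implicit Defensive.

Import Order.TTheory GRing.Theory Num.Theory.
Import numFieldNormedType.Exports.

Local Open Scope classical_set_scope.
Local Open Scope ring_scope.

(** * Kingman's subadditive ergodic theorem *)

(** When growth is only known to be at least quadratic, a finitely supported walk may be recurrent,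
    as on the square lattice; hence the long jumps. With radii of order 4^k and weights of order
    beta^-k, the first moment, which Kingman's theorem requires, asks for beta > 4, and the Green
    series, with terms of order (beta / 16)^k, asks for beta < 16; beta = 8 lies between. The level
    is redrawn at every step, so depth never accumulates: the n-step probabilities for n > 0, and
    the Green function without its time-zero term, are exactly a function of the group increment
    times the mass of the endpoint. That mass cancels in the Green metric. In the n-step probability
    its logarithm is linear in a height of finite mean, which is o(n) along almost every trajectory.
    The three constants must be chosen before the probability space and the process. The exceptional
    sets are therefore fixed in a space of sequences and are null for every Bernoulli law on it; the
    increments of any given process have such a law, so no infinite product measure is ever
    constructed. *)

Section Kingman.
Context d (E : measurableType d) (R : realType) (Q : probability E R).
Variable theta : E -> E.
Hypothesis mtheta : measurable_fun [set: E] theta.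
Hypothesis inv_theta : forall A, measurable A -> Q (theta @^-1` A) = Q A.
Hypothesis erg_theta : forall A, measurable A -> theta @^-1` A `<=` A ->
  Q A = 0%E \/ Q A = 1%E.

Implicit Types (f F : nat -> E -> R) (phi B : E -> R).

Lemma measurable_iter k : measurable_fun [set: E] (iter k theta).
Proof.
elim: k => [|k IH]; first exact: measurable_id.
exact: measurableT_comp mtheta IH.
Qed.

Lemma ge0_integral_iter phi k : measurable_fun setT phi -> (forall s, 0 <= phi s) ->
  (\int[Q]_s (phi (iter k theta s))%:E = \int[Q]_s (phi s)%:E)%E.
Proof.
move=> mphi phi0; elim: k => // k IH; rewrite -IH.
have mk : measurable_fun setT (fun s => (phi (iter k theta s))%:E).
  apply/measurable_EFinP; apply: measurableT_comp => //; exact: measurable_iter.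
under eq_integral do rewrite iterSr.
have := @ge0_integral_pushforward _ _ _ _ R _ mtheta Q setT
  (fun s => (phi (iter k theta s))%:E) measurableT mk.
rewrite preimage_setT => <-; last by move=> s _; rewrite lee_fin phi0.
apply: eq_measure_integral => A mA _; exact: inv_theta.
Qed.

Definition subadditive F := forall n m s, F (n + m)%N s <= F n s + F m (iter n theta s).

Definition birkhoff phi n s := \sum_(k < n) phi (iter k theta s).

Lemma birkhoffD phi n m s :
  birkhoff phi (n + m) s = birkhoff phi n s + birkhoff phi m (iter n theta s).
Proof.
rewrite /birkhoff big_split_ord /=; congr (_ + _).
by apply: eq_bigr => k _; rewrite -iterD addnC.
Qed.

Lemma measurable_birkhoff phi n : measurable_fun setT phi ->
  measurable_fun setT (birkhoff phi n).
Proof.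
move=> mphi; apply: measurable_sum => k.
apply: measurableT_comp => //; exact: measurable_iter.
Qed.

Lemma birkhoff1 phi s : birkhoff phi 1 s = phi s.
Proof. by rewrite /birkhoff big_ord1. Qed.

Lemma subadditive_birkhoff F n s : subadditive F -> F n.+1 s <= birkhoff (F 1) n.+1 s.
Proof.
move=> subF; elim: n s => [|n IH] s; first by rewrite birkhoff1.
rewrite -add1n (le_trans (subF _ _ _))// birkhoffD birkhoff1 lerD2l; exact: IH.
Qed.

Definition always_above F (c : R) (M : nat) : set E :=
  [set s | forall n, (0 < n <= M)%N -> c * n%:R < F n s].

Lemma measurable_always_above F c M : (forall n, measurable_fun setT (F n)) ->
  measurable (always_above F c M).
Proof.
move=> mF; rewrite (_ : always_above F c M =
    \bigcap_(n in [set n | (0 < n <= M)%N]) (F n @^-1` `]c * n%:R, +oo[)).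
  apply: bigcap_measurableType => n _; rewrite -[X in measurable X]setTI; exact: mF.
by apply/seteqP; split=> s /= h n hn; have := h n hn; rewrite /= in_itv/= andbT.
Qed.

Definition forever_above F (c : R) : set E :=
  [set s | forall n, (0 < n)%N -> c * n%:R < F n s].

Lemma forever_aboveE F c : forever_above F c = \bigcap_M always_above F c M.
Proof.
apply/seteqP; split=> s h; first by move=> M _ n /andP[n0 _]; exact: h.
by move=> n n0; apply: (h n) => //; rewrite n0 leqnn.
Qed.

Lemma measurable_forever_above F c : (forall n, measurable_fun setT (F n)) ->
  measurable (forever_above F c).
Proof.
move=> mF; rewrite forever_aboveE; apply: bigcap_measurableType => M _.
exact: measurable_always_above.
Qed.

(* The Katznelson--Weiss covering: jump along blocks of length <= M on which F
   is at most c times the length, and by single steps elsewhere. *)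
Lemma covering F c M B s n : subadditive F -> (forall t, 0 <= B t) ->
  (forall t, F 1%N t <= c + B t) -> (0 < n)%N ->
  F n s <= c * n%:R + \sum_(k < n) B (iter k theta s) *
     (\1_(always_above F c M) (iter k theta s) + (n <= k + M)%N%:R).
Proof.
move=> subF B0 F1 n0.
pose a k m t := B (iter k theta t) *
     (\1_(always_above F c M) (iter k theta t) + (m <= k + M)%N%:R) : R.
have a0 k m t : 0 <= a k m t.
  by rewrite mulr_ge0// addr_ge0// ?ler0n// indicE ler0n.
rewrite -/(a _ n s).
elim/ltn_ind: n s n0 => n IH s n0.
have [step|] := pselect (always_above F c M s \/ (n <= M)%N).
  have Ba : B s <= a 0%N n s.
    rewrite /a /= add0n ler_peMr//.
    case: step => [h|->]; last by rewrite lerDr indicE ler0n.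
    by rewrite indicE mem_set// lerDl ler0n.
  case: n n0 IH Ba {step} => // -[_ _ Ba|n _ IH Ba].
    by rewrite mulr1 big_ord1; apply: le_trans (F1 _) _; rewrite lerD2l.
  rewrite -add1n (le_trans (subF _ _ _))//.
  rewrite big_split_ord /= big_ord1 natrD mulrDr mulr1 addrACA lerD//.
    by apply: le_trans (F1 s) _; rewrite lerD2l.
  apply: le_trans (IH n.+1 _ (theta s) _) _ => //.
  rewrite lerD2l ler_sum// => k _; rewrite /a.
  by rewrite add0n -!iterS -!iterSr.
move=> /not_orP[/existsNP[j /not_implyP[/andP[j0 jM] /negP]]].
rewrite -leNgt => Fj /negP; rewrite -ltnNge => Mn.
have jn : (j < n)%N by exact: leq_ltn_trans Mn.
rewrite -(subnKC (ltnW jn)) (le_trans (subF _ _ _))//.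
rewrite natrD mulrDr -addrA; apply: lerD => //.
apply: le_trans (IH (n - j)%N _ (iter j theta s) _) _; rewrite ?subn_gt0//.
  by rewrite ltn_subrL j0.
rewrite lerD2l big_split_ord /=; apply: ler_wpDl.
  by apply: sumr_ge0 => k _; exact: a0.
apply: ler_sum => k _.
rewrite (addnC j k) iterD; apply: ler_wpM2l => //; rewrite lerD2l ler_nat.
set b1 := (n - j <= _)%N; set b2 := (_ <= _ + M)%N; have -> : b1 = b2 by rewrite /b1 /b2 /=; lia.
exact: leqnn.
Qed.

(** If [forever_above F c] were null, the B-mass of the bad points of the covering would tend to 0
    as M grows, and the excess of F n over c n would integrate to less than eps n. The last
    hypothesis bounds the excess from below through its nonnegative majorants Z, so that F n, whose
    sign is arbitrary, is never integrated. *)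
Lemma not_forever_above F c B (eps : R) : (forall n, measurable_fun setT (F n)) ->
  subadditive F -> measurable_fun setT B -> (forall t, 0 <= B t) ->
  (forall t, F 1%N t <= c + B t) -> (\int[Q]_s (B s)%:E < +oo)%E -> 0 < eps ->
  (forall n (Z : E -> R), (0 < n)%N -> measurable_fun setT Z ->
     (forall s, 0 <= Z s) -> (forall s, F n s <= c * n%:R + Z s) ->
     ((eps * n%:R)%:E <= \int[Q]_s (Z s)%:E)%E) ->
  (0 < Q (forever_above F c))%E.
Proof.
move=> mF subF mB B0 F1 Boo eps0 Hint; rewrite lt0e measure_ge0 andbT.
apply/eqP => Q0.
pose Bad M := always_above F c M.
have mBad M : measurable (Bad M) by exact: measurable_always_above.
pose beta M := (\int[Q]_s (B s * \1_(Bad M) s)%:E)%E.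
have mB1 (A : set E) : measurable A -> measurable_fun setT (fun s => B s * \1_A s).
  by move=> mA; apply: measurable_funM => //; exact: measurable_indic.
have intB : Q.-integrable setT (EFin \o B).
  apply/integrableP; split; first exact/measurable_EFinP.
  by under eq_integral do rewrite /= ger0_norm//.
have beta_cvg : beta M @[M --> \oo] --> 0%E.
  pose Bf s := (B s * \1_(forever_above F c) s)%:E.
  have -> : 0%E = (\int[Q]_s Bf s)%E.
    apply/esym; rewrite (ae_eq_integral (cst 0%E)) ?integral0//.
      by apply/measurable_EFinP/mB1; exact: measurable_forever_above.
    exists (forever_above F c); split=> //; first exact: measurable_forever_above.
    move=> s /= /existsNP[_ /eqP]; rewrite /Bf indicE.
    by case: (boolP (s \in _)) => [/set_mem//|]; rewrite mulr0 eqxx.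
  have [||||| _ _ //] := @dominated_convergence _ _ _ Q setT measurableT
    (fun M s => (B s * \1_(Bad M) s)%:E) Bf (EFin \o B).
  - by move=> M; apply/measurable_EFinP/mB1.
  - by apply/measurable_EFinP/mB1; exact: measurable_forever_above.
  - apply: aeW => s _; apply: cvg_near_cst; rewrite /Bf.
    have [sf|/existsNP[M /not_implyP[M0 nM]]] := pselect (forever_above F c s).
      apply: nearW => M; rewrite !indicE !mem_set//.
      by move=> m /andP[m0 _]; exact: sf.
    exists M => // M' /= MM'; rewrite !indicE !memNset// => h; apply: nM; apply: h => //.
    by rewrite M0.
  - exact: intB.
  - apply: aeW => s n _ /=; rewrite lee_fin ger0_norm; last by rewrite mulr_ge0// indicE ler0n.
    by rewrite indicE ler_piMr//; case: (_ \in _).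
have b_fin : (\int[Q]_s (B s)%:E)%E \is a fin_num.
  by rewrite ge0_fin_numE// integral_ge0// => s _; rewrite lee_fin.
pose b := fine (\int[Q]_s (B s)%:E)%E.
have b0 : 0 <= b by apply: fine_ge0; apply: integral_ge0 => s _; rewrite lee_fin.
have [M [r betaM re]] : exists M, exists2 r, beta M = r%:E & r < eps / 2.
  have e2 : 0 < eps / 2 by rewrite divr_gt0.
  have /fine_cvgP[bfin /cvgrPdist_lt/(_ _ e2) bsmall] := beta_cvg.
  have [M [Mfin]] := filter_ex (filterI bfin bsmall).
  rewrite /= sub0r normrN => Msmall; exists M, (fine (beta M)); rewrite ?fineK//.
  by apply: le_lt_trans Msmall; exact: ler_norm.
(* The integrated covering has two costs: r for each of the n times, from the bad set, and b for
   each of the last M times, where a block may no longer fit. *)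
have key n : (0 < n)%N -> eps * n%:R <= r * n%:R + b * M%:R.
  move=> n0.
  pose phi k t := B t * (\1_(Bad M) t + (n <= k + M)%N%:R).
  have phi0 k t : 0 <= phi k t by rewrite mulr_ge0// addr_ge0// indicE ler0n.
  have mphi k : measurable_fun setT (phi k).
    apply: measurable_funM => //; apply: measurable_funD => //.
  have mphik k : measurable_fun setT (fun s => phi k (iter k theta s)).
    by apply: measurableT_comp => //; exact: measurable_iter.
  have mZ : measurable_fun setT (fun s => \sum_(k < n) phi k (iter k theta s)).
    by apply: measurable_sum => k; exact: mphik.
  have := Hint n _ n0 mZ (fun s => sumr_ge0 _ (fun k _ => phi0 _ _))
    (fun s => covering M s subF B0 F1 n0).
  under eq_integral do rewrite -sumEFin.
  rewrite ge0_integral_sum//; last 2 first.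
  - by move=> k; apply/measurable_EFinP; exact: mphik.
  - by move=> k s _; rewrite lee_fin.
  under eq_bigr do rewrite ge0_integral_iter//.
  have intphi k : (\int[Q]_s (phi k s)%:E = (r + b * (n <= k + M)%N%:R)%:E)%E.
    under eq_integral do rewrite /phi mulrDr EFinD.
    rewrite ge0_integralD//; last 4 first.
    - by move=> s _; rewrite lee_fin mulr_ge0// indicE ler0n.
    - by apply/measurable_EFinP/mB1.
    - by move=> s _; rewrite lee_fin mulr_ge0.
    - by apply/measurable_EFinP/measurable_funM.
    rewrite EFinD -betaM; congr (_ + _)%E; under eq_integral do rewrite EFinM muleC.
    rewrite ge0_integralZl//; last 2 first.
    - by apply/measurable_EFinP.
    - by move=> s _; rewrite lee_fin.
    by rewrite muleC EFinM fineK.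
  under eq_bigr do rewrite intphi.
  rewrite sumEFin lee_fin => /le_trans; apply.
  rewrite big_split /= sumr_const card_ord -(mulr_natr r) lerD2l -mulr_sumr.
  apply: ler_wpM2l => //; rewrite -natr_sum ler_nat (reindex_inj rev_ord_inj) /=.
  apply: (@leq_trans (\sum_(k < n) (k < M))%N).
    apply: leq_sum => k _; have := ltn_ord k; case: (ltnP k M); case: leqP => //; lia.
  elim: (n) => [|n' IH]; first by rewrite big_ord0.
  rewrite big_ord_recr /=; case: ltnP => n'M; last by rewrite addn0.
  rewrite addn1; apply: leq_ltn_trans n'M.
  apply: leq_trans (_ : \sum_(k < n') 1 <= _)%N; first by apply: leq_sum => k _; case: (_ < _)%N.
  by rewrite sum_nat_const card_ord muln1.
have e2 : 0 < eps - r by rewrite subr_gt0 (lt_le_trans re)// ler_pdivrMr// ler_peMr ?ler1n// ltW.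
pose n := (Num.truncn (b * M%:R / (eps - r))).+1.
have : b * M%:R / (eps - r) < n%:R by exact: truncnS_gt.
rewrite ltr_pdivrMr// => h; have := key n isT; lra.
Qed.

(** The event that the lower limit of F n / n is less than c. The margin 1/(j+1) leaves room for the
    term F 1 that appears when the starting point moves. *)
Definition often_below F c : set E :=
  [set s | exists j, forall m, exists2 n, (m <= n)%N & F n s <= (c - j.+1%:R^-1) * n%:R].

Lemma measurable_often_below F c : (forall n, measurable_fun setT (F n)) ->
  measurable (often_below F c).
Proof.
move=> mF; rewrite (_ : often_below F c = \bigcup_j \bigcap_m
    \bigcup_(n in [set n | (m <= n)%N]) (F n @^-1` `]-oo, (c - j.+1%:R^-1) * n%:R])).
  apply: bigcup_measurable => j _; apply: bigcap_measurableType => m _.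
  apply: bigcup_measurable => n _; rewrite -[X in measurable X]setTI; exact: mF.
apply/seteqP; split=> [s [j h]|s [j _ h]]; exists j => // m.
  by move=> _; have [n mn Fn] := h m; exists n => //=; rewrite in_itv.
by have [n mn] := h m I; rewrite /= in_itv/= => Fn; exists n.
Qed.

(** F (n+1) s exceeds F n (theta s) by at most F 1 s, which for large n is paid for by shrinking the
    margin from 1/(j+1) to 1/(j+2). Subadditivity yields this inclusion only, whence the one-sided
    form of [erg_theta]. *)
Lemma often_below_shift F c : subadditive F ->
  theta @^-1` (often_below F c) `<=` often_below F c.
Proof.
move=> subF s [j h]; exists j.+1 => m.
pose delta : R := j.+1%:R^-1 - j.+2%:R^-1.
have delta0 : 0 < delta by rewrite subr_gt0 ltf_pV2 ?posrE ?ltr0n// ltr_nat.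
pose m0 := (Num.truncn (`|F 1%N s - c + j.+2%:R^-1| / delta)).+1.
have [n] := h (maxn m m0); rewrite geq_max => /andP[mn m0n] Fn.
exists n.+1; first exact: leqW.
rewrite -add1n; apply: le_trans (subF 1%N n s) _; rewrite /=.
have : `|F 1%N s - c + j.+2%:R^-1| < delta * n%:R.
  rewrite mulrC -ltr_pdivrMr//; apply: lt_le_trans (truncnS_gt _) _.
  by rewrite ler_nat.
have := ler_norm (F 1%N s - c + j.+2%:R^-1).
have -> : (1 + n)%:R = 1 + n%:R :> R by rewrite natrD.
move: Fn; rewrite /delta.
move: (j.+1%:R^-1) (j.+2%:R^-1) (n%:R) => u v w; nra.
Qed.

(** An event disjoint from one of positive probability cannot have probability 1, so the zero-one
    law makes [often_below F c] null. Thresholds of the form g - 1/(j+1) reduce all c < g to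
    countably many null sets. *)
Lemma eventually_above F g : (forall n, measurable_fun setT (F n)) -> subadditive F ->
  (forall c, c < g -> (0 < Q (forever_above F c))%E) ->
  {ae Q, forall s c, c < g -> \forall n \near \oo, c * n%:R < F n s}.
Proof.
move=> mF subF pos.
have Q0 c : c < g -> Q (often_below F c) = 0%E.
  move=> cg; have mA := measurable_often_below c mF.
  have [//|A1] := erg_theta mA (@often_below_shift F c subF).
  have mB := measurable_forever_above c mF.
  have disj : often_below F c `&` forever_above F c = set0.
    apply/seteqP; split => // s [[j h] fs].
    have [n n0 Fn] := h 1%N; have := fs _ n0; apply/negP; rewrite -leNgt.
    apply: le_trans Fn _; rewrite ler_wpM2r// gerBl invr_ge0//.
  have : (Q (often_below F c) + Q (forever_above F c) <= 1)%E.
    by rewrite -measureU//; apply: probability_le1; exact: measurableU.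
  move=> h; exfalso; move: h (pos _ cg); rewrite A1.
  rewrite -(fineK (fin_num_measure Q _ mB)) lte_fin.
  set b := fine _ => b1 b0; have : ((1 + b)%:E <= 1%:E)%E by rewrite EFinD.
  by rewrite lee_fin; lra.
have ae_n : {ae Q, forall s j, ~ often_below F (g - j.+1%:R^-1) s}.
  apply/ae_foralln => j; exists (often_below F (g - j.+1%:R^-1)); split.
  - exact: measurable_often_below.
  - by apply: Q0; rewrite gtrBl invr_gt0.
  - by move=> s /contrapT.
apply: filterS ae_n => s ns c cg.
(* Two margins 1/(j+1) must fit between c and g: the distance of the threshold from g, and the one
   built into [often_below]. *)
pose j := Num.truncn ((g - c)^-1 * 2).
have gc : 0 < g - c by rewrite subr_gt0.
have jgc : j.+1%:R^-1 + j.+1%:R^-1 < g - c.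
  have j0 : 0 < j.+1%:R :> R by [].
  suff : 2 / j.+1%:R < g - c by set x := _%:R^-1; lra.
  rewrite ltr_pdivrMr// -ltr_pdivrMl//; exact: truncnS_gt.
have /forallNP/(_ j)/existsNP[m nm] : ~ often_below F (g - j.+1%:R^-1) s by exact: ns.
near=> n; rewrite ltNge; apply/negP => Fn; apply: nm; exists n.
  by near: n; exists m.
by apply: le_trans Fn _; rewrite ler_wpM2r//; move: jgc; set x := _%:R^-1; lra.
Unshelve. all: by end_near. Qed.

Lemma integral_birkhoff phi n : measurable_fun setT phi -> (forall s, 0 <= phi s) ->
  (\int[Q]_s (birkhoff phi n s)%:E = n%:R%:E * \int[Q]_s (phi s)%:E)%E.
Proof.
move=> mphi phi0; under eq_integral do rewrite -sumEFin.
rewrite ge0_integral_sum//; last 2 first.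
- move=> k; apply/measurable_EFinP; apply: measurableT_comp => //; exact: measurable_iter.
- by move=> k s _; rewrite lee_fin.
under eq_bigr do rewrite ge0_integral_iter//.
elim: n => [|n IH]; first by rewrite big_ord0 mul0e.
by rewrite big_ord_recr /= IH -[in RHS]addn1 natrD EFinD ge0_muleDl// ?mul1e ?lee_fin.
Qed.

Lemma subadditive_lower f g : (forall n, measurable_fun setT (f n)) ->
  (forall n s, 0 <= f n s) -> subadditive f -> (\int[Q]_s (f 1%N s)%:E < +oo)%E ->
  (forall n, (0 < n)%N -> ((g * n%:R)%:E <= \int[Q]_s (f n s)%:E)%E) ->
  {ae Q, forall s c, c < g -> \forall n \near \oo, c * n%:R < f n s}.
Proof.
move=> mf f0 subf foo gf; apply: eventually_above => // c cg.
have [c0|c0] := ltP c 0.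
  rewrite (_ : forever_above f c = setT); first by rewrite probability_setT lte01.
  apply/seteqP; split => // s _ n n0; apply: lt_le_trans (f0 n s).
  by rewrite nmulr_rlt0// ltr0n.
have gc : 0 < g - c by rewrite subr_gt0.
apply: (@not_forever_above f c (f 1%N) (g - c)) => // [t|n Z n0 mZ Z0 fZ].
  by rewrite lerDr.
have : (\int[Q]_s (f n s)%:E <= (c * n%:R)%:E + \int[Q]_s (Z s)%:E)%E.
  have -> : ((c * n%:R)%:E = \int[Q]_s cst (c * n%:R)%:E s)%E.
    by rewrite integral_cst// [X in (_ * X)%E](probability_setT Q) mule1.
  have mZ' : measurable_fun setT (fun s => (Z s)%:E) by exact/measurable_EFinP.
  have Z0' s : setT s -> (0 <= (Z s)%:E)%E by rewrite lee_fin.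
  have c0' (s : E) : setT s -> (0 <= cst (c * n%:R)%:E s)%E by rewrite lee_fin mulr_ge0.
  rewrite -ge0_integralD//=.
  apply: ge0_le_integral => //.
  - by move=> s _; rewrite lee_fin.
  - exact/measurable_EFinP.
  - by apply/measurable_EFinP/measurable_funD.
  - by move=> s _; rewrite lee_fin.
move=> h; have := le_trans (gf n n0) h; rewrite mulrBl EFinB.
by rewrite leeBlDl.
Qed.

(** The lower bound is applied to the additive sequence [- birkhoff phi], which is nonpositive; this
    is why [eventually_above] and [not_forever_above] assume no sign. *)
Lemma birkhoff_upper phi (i : R) : measurable_fun setT phi -> (forall s, 0 <= phi s) ->
  (\int[Q]_s (phi s)%:E = i%:E)%E ->
  {ae Q, forall s c, i < c -> \forall n \near \oo, birkhoff phi n s < c * n%:R}.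
Proof.
move=> mphi phi0 phii.
have i0 : 0 <= i by rewrite -lee_fin -phii; apply: integral_ge0 => s _; rewrite lee_fin.
have : {ae Q, forall s c, c < - i -> \forall n \near \oo, c * n%:R < - birkhoff phi n s}.
  apply: (@eventually_above (fun n s => - birkhoff phi n s)).
  - by move=> n; apply: measurable_funN; exact: measurable_birkhoff.
  - by move=> n m s; rewrite birkhoffD opprD.
  move=> c ci; have ci' : 0 < - i - c by rewrite subr_gt0.
  apply: (@not_forever_above (fun n s => - birkhoff phi n s) c (cst (- c)) (- i - c)) => //.
  - by move=> n; apply: measurable_funN; exact: measurable_birkhoff.
  - by move=> n m s; rewrite birkhoffD opprD.
  - by move=> t; rewrite /cst; lra.
  - by move=> t; rewrite /cst birkhoff1 subrr oppr_le0.
  - by rewrite (integral_cst Q measurableT (- c)%:E) [X in (_ * X)%E](probability_setT Q) mule1 ltry.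
  move=> n Z n0 mZ Z0 cZ.
  have : ((- c * n%:R)%:E <= n%:R%:E * i%:E + \int[Q]_s (Z s)%:E)%E.
    have mZ' : measurable_fun setT (fun s => (Z s)%:E) by exact/measurable_EFinP.
    have Z0' s : setT s -> (0 <= (Z s)%:E)%E by rewrite lee_fin.
    have b0' s : setT s -> (0 <= (birkhoff phi n s)%:E)%E.
      by rewrite lee_fin => _; apply: sumr_ge0.
    have mb' : measurable_fun setT (fun s => (birkhoff phi n s)%:E).
      by apply/measurable_EFinP; exact: measurable_birkhoff.
    rewrite -phii -integral_birkhoff// -ge0_integralD//.
    have -> : ((- c * n%:R)%:E = \int[Q]_s cst (- c * n%:R)%:E s)%E.
      by rewrite integral_cst// [X in (_ * X)%E](probability_setT Q) mule1.
    apply: ge0_le_integral => //.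
    - by move=> s _; rewrite lee_fin mulr_ge0//; lra.
    - by apply/measurable_EFinP/measurable_funD => //; exact: measurable_birkhoff.
    - by move=> s _; have := cZ s; rewrite lee_fin /cst; lra.
  have -> : (- i - c) * n%:R = - c * n%:R - n%:R * i by ring.
  by rewrite -EFinM EFinB leeBlDl.
apply: filterS => s h c ic; have := h (- c); rewrite ltrN2 => /(_ ic).
by apply: filterS => n; rewrite mulNr ltrN2.
Qed.

(** The rate is the infimum of the normalized integrals. For the upper bound, cutting into blocks of
    length N+1 would call for ergodicity of the iterate of theta of order N+1, which does not follow
    from that of theta. Averaging over all N+1 offsets of the blocks produces instead a Birkhoff sum
    of f (N+1) along theta itself. *)
Theorem subadditive_ergodic f : (forall n, measurable_fun setT (f n)) ->
  (forall n s, 0 <= f n s) -> subadditive f -> (\int[Q]_s (f 1%N s)%:E < +oo)%E ->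
  exists g : R, {ae Q, forall s, f n s / n%:R @[n --> \oo] --> g}.
Proof.
move=> mf f0 subf foo.
have int0 n : (0 <= \int[Q]_s (f n s)%:E)%E.
  by apply: integral_ge0 => s _; rewrite lee_fin.
have intS n : (\int[Q]_s (f n.+1 s)%:E < +oo)%E.
  apply: (@le_lt_trans _ _ (\int[Q]_s (birkhoff (f 1%N) n.+1 s)%:E)%E).
    apply: ge0_le_integral => //.
    - by move=> s _; rewrite lee_fin.
    - exact/measurable_EFinP.
    - by apply/measurable_EFinP; exact: measurable_birkhoff.
    - by move=> s _; rewrite lee_fin; exact: subadditive_birkhoff.
  by rewrite integral_birkhoff// lte_mul_pinfty// ?lee_fin.
pose J n := fine (\int[Q]_s (f n s)%:E)%E.
have JE n : (0 < n)%N -> (\int[Q]_s (f n s)%:E)%E = (J n)%:E.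
  by case: n => // n _; rewrite /J fineK// ge0_fin_numE.
have J0 n : 0 <= J n by exact: fine_ge0.
pose V := [set J n.+1 / n.+1%:R | n in [set: nat]].
have V_inf : has_inf V.
  split; first by exists (J 1%N / 1), 0%N.
  by exists 0 => _ [n _ <-]; rewrite divr_ge0.
pose g := inf V; exists g.
have gJ n : (0 < n)%N -> g * n%:R <= J n.
  case: n => // n _; rewrite -ler_pdivlMr//; apply: ge_inf; first by case: V_inf.
  by exists n.
have low : {ae Q, forall s c, c < g -> \forall n \near \oo, c * n%:R < f n s}.
  by apply: subadditive_lower => // n n0; rewrite JE// lee_fin gJ.
have low1 : {ae Q, forall s c, c < J 1%N ->
    \forall n \near \oo, c * n%:R < birkhoff (f 1%N) n s}.
  apply: (@subadditive_lower (fun n s => birkhoff (f 1%N) n s)).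
  - by move=> n; exact: measurable_birkhoff.
  - by move=> n s; exact: sumr_ge0.
  - by move=> n m s; rewrite birkhoffD.
  - by under eq_integral do rewrite birkhoff1.
  - by move=> n n0; rewrite integral_birkhoff// JE// -EFinM mulrC.
have up : {ae Q, forall s N c, J N.+1 < c ->
    \forall n \near \oo, birkhoff (f N.+1) n s < c * n%:R}.
  by apply/ae_foralln => N; apply: birkhoff_upper => //; rewrite JE.
apply: filterS3 low low1 up => s low low1 up.
apply/cvgrPdist_lt => e e0.
have [_ [N _ <-] JN] : exists2 x, V x & x < g + e / 4 by apply: inf_adherent => //; lra.
set N1 := N.+1%:R : R in JN; have N10 : 0 < N1 by rewrite ltr0n.
have N11 : 1 <= N1 by rewrite ler1n.
rewrite ltr_pdivrMr// in JN.
(* Shares of e: 1/4 for the choice of N, 3/16 for the Birkhoff estimates of f (N+1) and of the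
   window increment (once and twice eta), 1/2 for the constant K. Their sum is less than 1. *)
pose eta := e / 16.
have eta0 : 0 < eta by rewrite divr_gt0.
pose A0 := \sum_(i < N.+1) f i s.
have tele n : \sum_(i < N.+1) f (n + i)%N s <= A0 + birkhoff (f N.+1) n s.
  elim: n => [|n IH]; first by rewrite /birkhoff big_ord0 addr0.
  have -> : \sum_(i < N.+1) f (n.+1 + i)%N s =
      \sum_(i < N.+1) f (n + i)%N s - f n s + f (n + N.+1)%N s.
    rewrite big_ord_recr [in RHS]big_ord_recl /= addn0 addSnnS.
    set S1 := \sum_(i < N) _; set S2 := \sum_(i < N) _.
    have -> : S1 = S2 by apply: eq_bigr => i _; rewrite addSnnS.
    by lra.
  have -> : birkhoff (f N.+1) n.+1 s = birkhoff (f N.+1) n s + f N.+1 (iter n theta s).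
    by rewrite /birkhoff big_ord_recr.
  have := subf n N.+1 s; have := f0 n s; lra.
(* Each f (n + i) is pushed forward to the common time n + N + 1; the cost is bounded by the
   Birkhoff increment of f 1 over the window, which is small compared with n because the Birkhoff
   averages of f 1 converge. *)
have key n : N1 * f (n + N.+1)%N s <= A0 + birkhoff (f N.+1) n s +
    N1 * (birkhoff (f 1%N) (n + N.+1)%N s - birkhoff (f 1%N) n s).
  apply: le_trans (_ : \sum_(i < N.+1) (f (n + i)%N s +
      (birkhoff (f 1%N) (n + N.+1)%N s - birkhoff (f 1%N) n s)) <= _).
    rewrite mulr_natl -[X in _ *+ X]card_ord -sumr_const; apply: ler_sum => i _.
    have iN := ltn_ord i.
    have -> : (n + N.+1 = (n + i) + (N - i).+1)%N by lia.
    apply: le_trans (subf _ _ _) _; rewrite lerD2l.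
    apply: le_trans (subadditive_birkhoff _ _ subf) _.
    rewrite [X in _ <= X - _]birkhoffD lerBrDr addrC lerD2r.
    by rewrite birkhoffD lerDl; apply: sumr_ge0.
  by rewrite big_split /= sumr_const card_ord -[X in _ + X <= _]mulr_natl lerD2r.
have upN := up N (J N.+1 + eta); have up1 := up 0%N (J 1%N + eta).
have lo1 := low1 (J 1%N - eta); have lo := low (g - e / 2).
have {}upN := upN ltac:(lra). have {}up1 := up1 ltac:(lra).
have {}lo1 := lo1 ltac:(lra). have {}lo := lo ltac:(lra).
pose K := A0 + N1 * (J 1%N + eta) * N1.
have g0 : 0 <= g by apply: lb_le_inf; [case: V_inf|move=> _ [n _ <-]; rewrite divr_ge0].
have [M1 _ {}upN] := upN; have [M2 _ {}up1] := up1.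
have [M3 _ {}lo1] := lo1; have [M4 _ {}lo] := lo.
pose M5 := (Num.truncn (K / (e / 2))).+1.
exists (N.+1 + (M1 + M2 + M3 + M4 + M5))%N => // n' /= hn'.
have [n En] : exists n, n' = (n + N.+1)%N.
  exists (n' - N.+1)%N; rewrite subnK//; apply: leq_trans hn'; exact: leq_addr.
have [[M1n M3n M5n] [M2n M4n n'_gt0]] :
    [/\ M1 <= n, M3 <= n & M5 <= n]%N /\ [/\ M2 <= n', M4 <= n' & 0 < n']%N.
  move: hn'; rewrite En; move: (M5) => m5; clear => h.
  by split; split; lia.
have {}upN := upN n M1n; have {}up1 := up1 n' M2n.
have {}lo1 := lo1 n M3n; have {}lo := lo n' M4n.
have n'0 : 0 < n'%:R :> R by rewrite ltr0n.
have Kn : K < e / 2 * n%:R.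
  rewrite mulrC -ltr_pdivrMr ?divr_gt0//; apply: lt_le_trans (truncnS_gt _) _.
  by rewrite -/M5 ler_nat.
have En' : n'%:R = n%:R + N1 :> R by rewrite En natrD.
have n0 : 0 <= n%:R :> R by [].
have {}key := key n; rewrite -En in key.
have JNn : J N.+1 * n%:R <= (g + e / 4) * N1 * n%:R by rewrite ler_wpM2r// ltW.
have eN : eta * n%:R <= eta * n%:R * N1 by rewrite ler_peMr// mulr_ge0// ltW.
have eN2 : e / 2 * n%:R <= e / 2 * n%:R * N1 by rewrite ler_peMr// mulr_ge0//; lra.
have gN : 0 <= (g + e) * N1 * N1 by rewrite !mulr_ge0//; lra.
have B1 : N1 * (birkhoff (f 1%N) n' s - birkhoff (f 1%N) n s) <=
    N1 * ((J 1%N + eta) * (n%:R + N1) - (J 1%N - eta) * n%:R).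
  by rewrite ler_pM2l// -En'; lra.
have fn' : N1 * f n' s < N1 * ((g + e) * n'%:R).
  rewrite En'; move: key upN B1 JNn eN eN2 gN Kn; rewrite /K /eta => *; nra.
rewrite ltr_pM2l// in fn'.
rewrite ltr_distlC ltr_pdivlMr// ltr_pdivrMr// fn' andbT.
by apply: le_lt_trans lo; rewrite ler_wpM2r//; lra.
Qed.

End Kingman.

(** * Bernoulli shifts *)

Lemma esumZl (R : realType) (T : choiceType) (D : set T) (c : R) (a : T -> \bar R) :
  0 <= c -> (forall t, 0 <= a t)%E ->
  (\esum_(t in D) (c%:E * a t) = c%:E * \esum_(t in D) a t)%E.
Proof.
have le b (u : T -> \bar R) : 0 <= b -> (forall t, 0 <= u t)%E ->
    (\esum_(t in D) (b%:E * u t) <= b%:E * \esum_(t in D) u t)%E.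
  move=> b0 u0; apply: ge_ereal_sup => _ [X XD <-].
  rewrite -ge0_mule_fsumr//; apply: lee_wpmul2l; first by rewrite lee_fin.
  by apply: ereal_sup_ubound; exists X.
rewrite le_eqVlt => /predU1P[<-|c0] a0.
  by rewrite mul0e esum1// => t _; rewrite mul0e.
apply/eqP; rewrite eq_le; apply/andP; split; first by apply: le => //; exact: ltW.
have cV : (c^-1%:E * c%:E = 1)%E by rewrite -EFinM mulVf// gt_eqF.
have := le c^-1 (fun t => c%:E * a t)%E.
under eq_esum do rewrite muleA cV mul1e.
rewrite invr_ge0 ltW// => /(_ isT) h.
rewrite -[leRHS]mul1e -(_ : c%:E * c^-1%:E = 1)%E; last by rewrite muleC.
rewrite -muleA; apply: lee_wpmul2l; first by rewrite lee_fin ltW.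
by apply: h => t; rewrite mule_ge0// lee_fin ltW.
Qed.

Lemma nneseries_code (R : realType) (T : choiceType) (code : T -> nat) (a : nat -> \bar R) :
  injective code -> (forall n, 0 <= a n)%E -> (forall n, ~ range code n -> a n = 0%E) ->
  (\sum_(n <oo) a n = \esum_(t in [set: T]) a (code t))%E.
Proof.
move=> code_inj a0 an0; rewrite nneseries_esumT// -(esum_image setT code); last first.
  by move=> x y _ _; exact: code_inj.
rewrite [RHS]esum_mkcond; apply: eq_esum => n _; case: ifPn => // nr.
by apply: an0; move: nr; rewrite notin_setE.
Qed.

Section Bernoulli.
Variables (R : realType) (T : pointedType) (code : T -> nat) (nu : T -> R).
Hypothesis code_inj : injective code.
Hypothesis nu0 : forall t, 0 <= nu t.
Hypothesis nu1 : (\esum_(t in [set: T]) (nu t)%:E = 1)%E.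

Definition cyl (n : nat) (t : nat -> T) : set (nat -> T) :=
  [set s | forall k, (k < n)%N -> s k = t k].

(** The empty set is included so that the family is closed under intersection, as uniqueness of
    measures on a generating family requires. *)
Definition cylinders : set (set (nat -> T)) :=
  [set A | A = set0 \/ exists n t, A = cyl n t].

Definition seqsp := g_sigma_algebraType cylinders.

Lemma setI_closed_cylinders : setI_closed cylinders.
Proof.
move=> A B [->|[n [t ->]]]; first by rewrite set0I => _; left.
move=> [->|[m [u ->]]]; first by rewrite setI0; left.
have [[s [sn sm]]|no] := pselect (cyl n t `&` cyl m u !=set0); last first.
  by left; apply: contrapT => /eqP/set0P.
right; exists (maxn n m), s; apply/seteqP; split=> v /=.
  move=> [vn vm] k; rewrite leq_max => /orP[kn|km].
    by rewrite vn// -sn.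
  by rewrite vm// -sm.
move=> h; split=> k km; rewrite h ?leq_max ?km ?orbT//; [exact: sn|exact: sm].
Qed.

Lemma measurable_cyl n t : measurable (cyl n t : set seqsp).
Proof. by apply: sub_sigma_algebra; right; exists n, t. Qed.

Lemma cyl0 t : cyl 0 t = setT.
Proof. by apply/seteqP; split. Qed.

Definition prefix_code n (s : nat -> T) : nat := pickle [seq code (s k) | k <- iota 0 n].

Lemma prefix_codeP n s s' : prefix_code n s = prefix_code n s' ->
  forall k, (k < n)%N -> s k = s' k.
Proof.
move=> /(pcan_inj pickleK) e k kn; apply: code_inj.
have := congr1 (nth 0%N ^~ k) e.
by rewrite !(nth_map 0%N) ?size_iota// !nth_iota.
Qed.

(** T is countable through [code], so there are countably many prefixes of length n, and the set is
    a countable union of cylinders. *)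
Lemma measurable_prefix n (A : set seqsp) :
  (forall s s', (forall k, (k < n)%N -> s k = s' k) -> A s -> A s') -> measurable A.
Proof.
move=> An; rewrite (_ : A = \bigcup_c (A `&` [set s | prefix_code n s = c])); last first.
  by apply/seteqP; split=> [s As|s [c _ []//]]; exists (prefix_code n s).
apply: bigcup_measurable => c _.
have [[s [As sc]]|no] := pselect (A `&` [set s | prefix_code n s = c] !=set0); last first.
  rewrite (_ : _ `&` _ = set0); first exact: measurable0.
  by apply: contrapT => /eqP/set0P.
rewrite (_ : _ `&` _ = cyl n s); first exact: measurable_cyl.
apply/seteqP; split=> v /=.
  by move=> [_ vc] k; apply: prefix_codeP; rewrite vc -sc.
move=> h; split; first by apply: An As => k kn; rewrite h.
rewrite -sc; congr pickle; apply/eq_in_map => k; rewrite mem_iota => kn.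
by rewrite h.
Qed.

Lemma measurable_prefix_fun n (f : seqsp -> R) :
  (forall s s', (forall k, (k < n)%N -> s k = s' k) -> f s = f s') ->
  measurable_fun setT f.
Proof.
move=> fn _ B mB; rewrite setTI; apply: (@measurable_prefix n) => s s' ss' /=.
by rewrite (fn s s').
Qed.

Definition shift (s : seqsp) : seqsp := fun k => s k.+1.

Lemma iter_shift n s k : iter n shift s k = s (n + k)%N.
Proof. by elim: n k => // n IH k; rewrite iterS /shift IH addSnnS. Qed.

Lemma measurable_shift : measurable_fun setT shift.
Proof.
apply: (@measurability _ _ seqsp seqsp setT shift cylinders) => // _ [_ [->|[n [t ->]]] <-].
  by rewrite preimage_set0 setI0.
rewrite setTI; apply: (@measurable_prefix n.+1) => s s' ss' h k kn.
by rewrite /shift -ss'//; exact: h.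
Qed.

Definition bernoulli_law (Q : set seqsp -> \bar R) : Prop :=
  forall n t, Q (cyl n t) = (\prod_(k < n) nu (t k))%:E.

Lemma cylinders_unique (m1 m2 : {measure set seqsp -> \bar R}) :
  (forall n t, m1 (cyl n t) = m2 (cyl n t)) -> (m1 setT < +oo)%E ->
  forall A, measurable A -> m1 A = m2 A.
Proof.
move=> m12 fin A mA.
apply: (@g_sigma_algebra_measure_unique _ R seqsp cylinders _ (fun=> setT)) => //.
- by move=> B; exact: sub_sigma_algebra.
- by move=> _; right; exists 0%N, point; rewrite cyl0.
- by rewrite bigcup_const//; exists 0%N.
- exact: setI_closed_cylinders.
- by move=> _ [->|[n [t ->]]]; rewrite ?measure0.
Qed.

Section Law.
Variable Q : probability seqsp R.
Hypothesis Qnu : bernoulli_law Q.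

Let measurable_coord_code n : measurable [set s : seqsp | code (s 0%N) = n].
Proof. by apply: (@measurable_prefix 1) => s s' ss' /= <-; rewrite ss'. Qed.

Lemma trivIset_coord_code : trivIset setT (fun n => [set s : seqsp | code (s 0%N) = n]).
Proof. by move=> i j _ _ [s [/= <- <-]]. Qed.

Lemma cover_coord_code : \bigcup_n [set s : seqsp | code (s 0%N) = n] = setT.
Proof. by apply/seteqP; split=> // s _; exists (code (s 0%N)). Qed.

Definition scons (x : T) (t : nat -> T) : nat -> T := fun k => if k is k'.+1 then t k' else x.

Lemma scons_cyl x n t : cyl n.+1 (scons x t) =
  shift @^-1` (cyl n t) `&` [set s | code (s 0%N) = code x].
Proof.
apply/seteqP; split=> s /=.
  by move=> h; split; [move=> k kn; rewrite /shift h|rewrite h].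
by move=> [h /code_inj h0] [|k] kn //=; rewrite -h.
Qed.

Lemma bernoulli_shift A : measurable A -> Q (shift @^-1` A) = Q A.
Proof.
have msh B : measurable B -> measurable (shift @^-1` B).
  by move=> mB; rewrite -[X in measurable X]setTI; exact: measurable_shift.
pose Qs := pushforward Q shift.
have Qs_eq : forall n t, Qs (cyl n t) = Q (cyl n t).
  move=> n t; rewrite /Qs /pushforward -[X in Q X]setIT -cover_coord_code setI_bigcupr.
  rewrite measure_bigcup//; last 2 first.
  - by move=> i _; apply: measurableI => //; apply: msh; exact: measurable_cyl.
  - by apply: trivIset_setIl; exact: trivIset_coord_code.
  rewrite (eq_eseriesl (Q := xpredT)); last by move=> i; rewrite in_setT.
  rewrite (nneseries_code code_inj)//; last first.
    move=> i ir; rewrite (_ : _ `&` _ = set0) ?measure0//.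
    by apply/seteqP; split=> // s [_ /= h]; apply: ir; exists (s 0%N).
  under eq_esum => x _ do rewrite -scons_cyl.
  transitivity (\esum_(x in [set: T]) (nu x * \prod_(k < n) nu (t k))%:E)%E.
    apply: eq_esum => x _; transitivity (\prod_(k < n.+1) nu (scons x t k))%:E.
      exact: Qnu.
    by rewrite big_ord_recl.
  transitivity (\prod_(k < n) nu (t k))%:E; last exact/esym/Qnu.
  rewrite -[RHS]mul1e -nu1.
  rewrite muleC -esumZl; last 2 first.
  - by apply: prodr_ge0.
  - by move=> x; rewrite lee_fin.
  by apply: eq_esum => x _; rewrite mulrC EFinM.
move=> mA; transitivity (Qs A) => //.
apply: (@cylinders_unique (pushforward Q shift) Q) => //.
- exact: measurable_shift.
- move=> ?; rewrite /= /pushforward preimage_setT.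
  by apply: le_lt_trans (probability_le1 Q measurableT) (ltry _).
Qed.

Lemma measurable_iter_shift n : measurable_fun setT (iter n shift).
Proof.
by elim: n => [|n IH]; [exact: measurable_id|exact: measurableT_comp measurable_shift IH].
Qed.

Lemma bernoulli_iter_shift n A : measurable A -> Q (iter n shift @^-1` A) = Q A.
Proof.
move=> mA; elim: n => // n <-.
rewrite (_ : iter n.+1 shift @^-1` A = shift @^-1` (iter n shift @^-1` A)).
  apply: bernoulli_shift; rewrite -[X in measurable X]setTI; exact: measurable_iter_shift.
by apply/seteqP; split=> s /=; rewrite -iterSr.
Qed.

(** Both sides are finite measures in A, and on cylinders they agree by concatenating the two
    prefixes. *)
Lemma bernoulli_independence n t A : measurable A ->
  Q (iter n shift @^-1` A `&` cyl n t) = (Q (cyl n t) * Q A)%E.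
Proof.
have p0 : 0 <= \prod_(k < n) nu (t k) by exact: prodr_ge0.
move=> mA; have mC := measurable_cyl n t.
have := @cylinders_unique
  (pushforward (mrestr Q mC) (iter n shift)) (mscale (NngNum p0) Q).
move=> h; transitivity (mscale (NngNum p0) Q A); last first.
  by rewrite /mscale/=; congr (_ * _)%E; exact/esym/Qnu.
apply: h => //.
- exact: measurable_iter_shift.
- move=> ? m u; transitivity (Q (iter n shift @^-1` (cyl m u) `&` cyl n t)) => //.
  transitivity ((\prod_(k < n) nu (t k))%:E * Q (cyl m u))%E => //.
  pose v k := if (k < n)%N then t k else u (k - n)%N.
  rewrite (_ : _ `&` _ = cyl (n + m) v).
    transitivity (\prod_(k < n + m) nu (v k))%:E; first exact: Qnu.
    rewrite big_split_ord /= EFinM; congr (_%:E * _)%E.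
      by apply: eq_bigr => k _; rewrite /v ltn_ord.
    transitivity (\prod_(k < m) nu (u k))%:E; last exact/esym/Qnu.
    by congr _%:E; apply: eq_bigr => k _; rewrite /v ltnNge leq_addr addKn.
  apply/seteqP; split=> s /=.
    move=> [hm hn] k knm; rewrite /v; case: ltnP => kn; first exact: hn.
    by rewrite -(hm (k - n)%N) ?ltn_subLR// iter_shift subnKC.
  move=> h; split=> k km.
    by rewrite iter_shift h ?ltn_add2l// /v ltnNge leq_addr addKn.
  by rewrite h ?ltn_addr// /v km.
- move=> ?; rewrite [X in (X < _)%E](_ : _ = Q (setT `&` cyl n t))//= setTI.
  by apply: le_lt_trans (probability_le1 Q mC) (ltry _).
Qed.

(** A and its n-th preimage differ by a null set, since one contains the other and they have equal
    measure. The preimage is independent of the first n coordinates, so A is independent of every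
    cylinder, hence of itself. *)
Lemma bernoulli_ergodic A : measurable A -> shift @^-1` A `<=` A ->
  Q A = 0%E \/ Q A = 1%E.
Proof.
move=> mA shA.
have mi n : measurable (iter n shift @^-1` A).
  by rewrite -[X in measurable X]setTI; exact: measurable_iter_shift.
have iA n : iter n shift @^-1` A `<=` A.
  by elim: n => // n IH s /= /shA; exact: IH.
have fin B : measurable B -> Q B \is a fin_num by move=> mB; exact: fin_num_measure.
have diff n : Q (A `\` iter n shift @^-1` A) = 0%E.
  rewrite measureD//; last by rewrite ltey_eq fin.
  rewrite setIidr; last exact: iA.
  transitivity (Q A - Q A)%E; last by rewrite subee// fin.
  by congr (_ - _)%E; exact: bernoulli_iter_shift.
have AC n t : Q (cyl n t `&` A) = (Q (cyl n t) * Q A)%E.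
  rewrite -bernoulli_independence//; apply/eqP; rewrite eq_le; apply/andP; split.
    apply: (@le_trans _ _ (Q ((iter n shift @^-1` A `&` cyl n t) `|`
        (A `\` iter n shift @^-1` A)))).
      apply: le_measure; rewrite ?inE.
      - by apply: measurableI => //; exact: measurable_cyl.
      - apply: measurableU; last exact: measurableD.
        by apply: measurableI => //; exact: measurable_cyl.
      - move=> s [cs As]; have [|ns] := pselect ((iter n shift @^-1` A) s); first by left.
        by right.
    set X := _ `&` cyl n t; set Y := A `\` _.
    have : (Q (X `|` Y) <= Q X + Q Y)%E.
      apply: measureU2; last exact: measurableD.
      by apply: measurableI => //; exact: measurable_cyl.
    by rewrite diff adde0.
  apply: le_measure; rewrite ?inE.
  - by apply: measurableI => //; exact: measurable_cyl.
  - by apply: measurableI => //; exact: measurable_cyl.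
  - by move=> s [/iA ? ?].
have a0 : 0 <= fine (Q A) by apply: fine_ge0.
have QA : (Q A = Q A * Q A)%E.
  have QAE : (fine (Q A))%:E = Q A by rewrite fineK// fin.
  have e : mrestr Q mA A = mscale (NngNum a0) Q A.
    apply: (@cylinders_unique (mrestr Q mA) (mscale (NngNum a0) Q)) => //.
    - move=> n t; transitivity (Q (cyl n t `&` A)) => //.
      transitivity ((fine (Q A))%:E * Q (cyl n t))%E => //.
      by rewrite AC QAE muleC.
    - rewrite [X in (X < _)%E](_ : _ = Q (setT `&` A))//= setTI.
      by apply: le_lt_trans (probability_le1 Q mA) (ltry _).
  transitivity (Q (A `&` A)); first by rewrite setIid.
  by transitivity ((fine (Q A))%:E * Q A)%E => //; rewrite QAE.
move: QA; rewrite -(fineK (fin A mA)) -EFinM => -[e].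
have /eqP : fine (Q A) * (fine (Q A) - 1) = 0 by rewrite mulrBr mulr1 -e subrr.
by rewrite mulf_eq0 subr_eq0 => /orP[/eqP ->|/eqP ->]; [left|right].
Qed.

Lemma integral_coord (F : T -> R) : (forall t, 0 <= F t) ->
  (\int[Q]_s (F (s 0%N))%:E = \esum_(t in [set: T]) (nu t * F t)%:E)%E.
Proof.
move=> F0.
have mF : measurable_fun setT (fun s : seqsp => (F (s 0%N))%:E).
  by apply/measurable_EFinP; apply: (@measurable_prefix_fun 1) => s s' ->.
rewrite -cover_coord_code ge0_integral_bigcup//; last 3 first.
- by rewrite cover_coord_code.
- by move=> s _; rewrite lee_fin.
- exact: trivIset_coord_code.
rewrite (nneseries_code code_inj); last 2 first.
- by move=> n; apply: integral_ge0 => s _; rewrite lee_fin.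
- move=> n nr; rewrite (_ : [set s | code (s 0%N) = n] = set0) ?integral_set0//.
  by apply/seteqP; split=> // s /= sn; apply: nr; exists (s 0%N).
apply: eq_esum => x _.
rewrite (eq_integral (cst (F x)%:E)); last by move=> s; rewrite inE /= => /code_inj ->.
rewrite integral_cst// EFinM muleC; congr (_ * _)%E.
rewrite (_ : [set s | code (s 0%N) = code x] = cyl 1 (fun=> x)).
  transitivity (\prod_(k < 1) nu x)%:E; first exact: Qnu.
  by rewrite big_ord1.
apply/seteqP; split=> s /=; first by move=> /code_inj h [|].
by move=> ->.
Qed.

End Law.

(* The exceptional set does not depend on the law, which is unique if it exists. *)
Theorem bernoulli_subadditive (f : nat -> (nat -> T) -> R) (F : T -> R) :
  (forall n s s', (forall k, (k < n)%N -> s k = s' k) -> f n s = f n s') ->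
  (forall n s, 0 <= f n s) ->
  (forall n m s, f (n + m)%N s <= f n s + f m (fun k => s (n + k)%N)) ->
  (forall s, f 1%N s = F (s 0%N)) ->
  (\esum_(t in [set: T]) (nu t * F t)%:E < +oo)%E ->
  exists (g : R) (B : set seqsp),
    [/\ measurable B,
        (forall Q : probability seqsp R, bernoulli_law Q -> Q B = 0%E) &
      forall s, ~ B s -> f n s / n%:R @[n --> \oo] --> g].
Proof.
move=> fpre f0 subf f1 Foo.
have [[Q Qnu]|no] := pselect (exists Q : probability seqsp R, bernoulli_law Q); last first.
  exists 0, setT; split=> //.
    by move=> Q Qnu; case: no; exists Q.
  by move=> s /(_ Logic.I).
have mf n : measurable_fun setT (f n : seqsp -> R).
  by apply: (@measurable_prefix_fun n); exact: fpre.
have subf' : subadditive shift f.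
  move=> n m s; apply: le_trans (subf n m s) _; rewrite lerD2l.
  rewrite le_eqVlt; apply/orP; left; apply/eqP; apply: fpre => k _.
  by rewrite iter_shift.
have F0 t : 0 <= F t by rewrite -(f1 (fun=> t)).
have int1 : (\int[Q]_s (f 1%N s)%:E < +oo)%E.
  by under eq_integral do rewrite f1; rewrite integral_coord.
have [g [B [mB QB sB]]] := subadditive_ergodic measurable_shift (bernoulli_shift Qnu)
  (bernoulli_ergodic Qnu) mf f0 subf' int1.
exists g, B; split=> // [Q' Q'nu|s nBs].
  rewrite -QB; apply: cylinders_unique => //.
    by move=> n t; transitivity (\prod_(k < n) nu (t k))%:E; [exact: Q'nu|exact/esym/Qnu].
  by apply: le_lt_trans (probability_le1 Q' measurableT) (ltry _).
by apply: contrapT => h; apply: nBs; exact: sB.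
Qed.

End Bernoulli.

(** * Green functions *)

Lemma esum_swap (R : realType) (T1 T2 : choiceType) (a : T1 -> T2 -> \bar R) :
  (forall i j, 0 <= a i j)%E ->
  (\esum_(i in [set: T1]) \esum_(j in [set: T2]) a i j =
   \esum_(j in [set: T2]) \esum_(i in [set: T1]) a i j)%E.
Proof.
move=> a0; rewrite !esum_esum//.
rewrite (reindex_esum ([set: T2] `*`` fun=> [set: T1]) _ (fun x => (x.2, x.1)))//.
split=> //=; first by move=> [i j] [i' j'] _ _ [-> ->].
by move=> [i j] _; exists (j, i).
Qed.

Lemma esum_ge1 (R : realType) (T : choiceType) (a : T -> \bar R) t :
  (forall i, 0 <= a i)%E -> (a t <= \esum_(i in [set: T]) a i)%E.
Proof. by move=> a0; apply: esum_ge; exists [set t] => //; rewrite fsbig_set1. Qed.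

Section Green.
Variables (R : realType) (X : choiceType) (p : X -> X -> R).
Hypothesis p0 : forall x y, 0 <= p x y.
Hypothesis p1 : forall x, (\esum_(y in [set: X]) (p x y)%:E <= 1)%E.
Local Open Scope ereal_scope.

Lemma nstep_ge0 n x y : 0 <= nstep p n x y.
Proof.
elim: n x => [|n IH] x /=; first by rewrite lee_fin; case: (x == y).
by apply: esum_ge0 => z _; rewrite mule_ge0// lee_fin.
Qed.
Hint Resolve nstep_ge0 : core.

Lemma step_ge0 x z (a : \bar R) : 0 <= a -> 0 <= (p x z)%:E * a.
Proof. by move=> a0; rewrite mule_ge0// lee_fin. Qed.
Hint Resolve step_ge0 : core.

Lemma nstep_le1 n x y : nstep p n x y <= 1.
Proof.
elim: n x => [|n IH] x /=; first by rewrite lee_fin; case: (x == y).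
apply: le_trans (p1 x); apply: le_esum => z _.
by rewrite -[leRHS]mule1; apply: lee_wpmul2l; rewrite ?lee_fin.
Qed.

Lemma nstep_fin n x y : nstep p n x y \is a fin_num.
Proof. by rewrite ge0_fin_numE// (le_lt_trans (nstep_le1 _ _ _))// ltry. Qed.

Lemma nstep1 x y : nstep p 1 x y = (p x y)%:E.
Proof.
have d0 z : 0 <= (p x z)%:E * ((z == y)%:R)%:E.
  by apply: step_ge0; rewrite lee_fin; case: (z == y).
rewrite /= (esumID [set y]); last by move=> z _; exact: d0.
rewrite !setTI esum_set1//.
rewrite eqxx mule1 esum1 ?adde0// => z /= /eqP/negbTE ->; exact: mule0.
Qed.

Lemma nstepD n k x y z : nstep p n x y * nstep p k y z <= nstep p (n + k) x z.
Proof.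
elim: n x => [|n IH] x /=.
  by case: eqP => [->|_]; rewrite ?mul1e// mul0e.
rewrite -(fineK (nstep_fin k y z)) muleC -esumZl; last 2 first.
- exact: fine_ge0.
- by move=> t; apply: step_ge0.
apply: le_esum => t _; rewrite muleC -muleA; apply: lee_wpmul2l; first by rewrite lee_fin.
by rewrite fineK ?nstep_fin//; exact: IH.
Qed.

Definition partial_green n x y : \bar R := \sum_(i < n) nstep p i x y.

Lemma partial_green_ge0 n x y : 0 <= partial_green n x y.
Proof. exact: sume_ge0. Qed.
Hint Resolve partial_green_ge0 : core.

Lemma partial_greenS n x y : partial_green n.+1 x y =
  ((x == y)%:R)%:E + \esum_(z in [set: X]) ((p x z)%:E * partial_green n z y).
Proof.
rewrite /partial_green big_ord_recl /=; congr (_ + _).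
rewrite -esum_sum//; last by move=> z i _ _; apply: step_ge0.
by apply: eq_esum => z _; rewrite ge0_sume_distrr.
Qed.

Lemma green_ge0 x y : 0 <= green p x y.
Proof. exact: nneseries_ge0. Qed.
Hint Resolve green_ge0 : core.

Lemma partial_green_le n x y : partial_green n x y <= green p x y.
Proof.
rewrite /partial_green -(big_mkord xpredT (fun i => nstep p i x y)).
exact: nneseries_lim_ge.
Qed.

Lemma green_le x y C : (forall n, partial_green n x y <= C) -> green p x y <= C.
Proof.
move=> h; apply: lime_le; first exact: is_cvg_nneseries.
by apply: nearW => n; rewrite big_mkord; exact: h.
Qed.

(** Agrees with the Green function off the diagonal. Without the time-zero term it will factor
    exactly through the group increment and the mass of the endpoint. *)
Definition green_plus x y : \bar R := \sum_(1 <= n <oo) nstep p n x y.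

Lemma green_plus_ge0 x y : 0 <= green_plus x y.
Proof. exact: nneseries_ge0. Qed.

Lemma greenE x y : green p x y = ((x == y)%:R)%:E + green_plus x y.
Proof. by rewrite /green nneseries_recl. Qed.

Lemma green_plusE x y :
  green_plus x y = \esum_(z in [set: X]) ((p x z)%:E * green p z y).
Proof.
rewrite /green_plus -nneseries_addn// nneseries_esumT//.
under eq_esum do rewrite addn1 /=.
rewrite esum_swap; last by move=> n z; apply: step_ge0.
apply: eq_esum => z _; rewrite -nneseriesZl// nneseries_esumT//.
by move=> n; apply: step_ge0.
Qed.

Lemma green_plus_ge n x y : (0 < n)%N -> nstep p n x y <= green_plus x y.
Proof.
move=> n0; apply: le_trans (_ : \sum_(1 <= i < n.+1) nstep p i x y <= _); last first.
  exact: nneseries_lim_ge.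
by rewrite big_nat_recr//= leeDr// sume_ge0.
Qed.

Lemma green_plus_step x z y : (p x z)%:E * green p z y <= green_plus x y.
Proof.
rewrite green_plusE.
by apply: (@esum_ge1 _ _ (fun z => (p x z)%:E * green p z y) z) => t; apply: step_ge0.
Qed.

(* Decomposing at the first visit to y, in the form of an induction on the number
   of summands of G(x,y). *)
Lemma green_mul x y z : transient p ->
  (green_fin p x y * green_fin p y z <= green_fin p y y * green_fin p x z)%R.
Proof.
move=> tr.
have gE u v : green p u v = (green_fin p u v)%:E.
  by rewrite /green_fin fineK// ge0_fin_numE.
have g0 u v : (0 <= green_fin p u v)%R by apply: fine_ge0.
suff main n : forall x, partial_green n x y * green p y z <= green p y y * green p x z.
  rewrite -lee_fin !EFinM -!gE.
  have [g0'|gn0] := eqVneq (green_fin p y z) 0%R.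
    by rewrite (gE y z) g0' mule0 mule_ge0.
  have gp : (0 < green_fin p y z)%R by rewrite lt_neqAle eq_sym gn0 g0.
  rewrite (gE y z) -lee_pdivlMr//; apply: green_le => n.
  by rewrite lee_pdivlMr// -gE; exact: main.
elim: n => [|n IH] {}x; first by rewrite /partial_green big_ord0 mul0e mule_ge0.
have [->|xy] := eqVneq x y.
  by apply: lee_wpmul2r => //; exact: partial_green_le.
rewrite partial_greenS (negbTE xy) add0e (gE y z) (gE y y) muleC -esumZl; last 2 first.
- exact: g0.
- by move=> t; apply: step_ge0.
apply: (@le_trans _ _ (\esum_(t in [set: X]) ((green_fin p y y)%:E * ((p x t)%:E * green p t z)))).
  apply: le_esum => t _; rewrite muleCA [leRHS]muleCA; apply: lee_wpmul2l.
    by rewrite lee_fin.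
  by rewrite muleC -gE -gE; exact: IH.
rewrite esumZl; last 2 first.
- exact: g0.
- by move=> t; apply: step_ge0.
apply: lee_wpmul2l; first by rewrite lee_fin.
rewrite -green_plusE greenE leeDr// lee_fin; by case: (_ == _).
Qed.

End Green.

(** * Green function of a mixture of reversible kernels *)

Section Mixture.
Variables (R : realType) (X : choiceType) (m : X -> R) (q : nat -> X -> X -> R).
Variables (w b c : nat -> R) (p : X -> X -> R).
Hypothesis m0 : forall x, 0 <= m x.
Hypothesis q0 : forall k x y, 0 <= q k x y.
Hypothesis q1 : forall k x, (\esum_(y in [set: X]) (q k x y)%:E = 1)%E.
Hypothesis q_rev : forall k x y, m x * q k x y = m y * q k y x.
Hypothesis q_le : forall k x y, q k x y <= c k * m y.
Hypothesis c0 : forall k, 0 <= c k.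
Hypothesis w0 : forall k, 0 <= w k.
Hypothesis b_gt0 : forall k, 0 < b k.
Hypothesis b0 : b 0%N = 1.
Hypothesis bS : forall k, b k = w k + b k.+1.
Hypothesis b_small : forall e, 0 < e -> exists K, b K < e.

Definition trunc_mix K x y : R := \sum_(k < K) w k * q k x y.

Hypothesis p_ge : forall K x y, trunc_mix K x y <= p x y.
Hypothesis p1 : forall x, (\esum_(y in [set: X]) (p x y)%:E = 1)%E.

(** The solution u of u = (1 - b k) u + w k c k / b k.+1: either a further step is taken with the
    first k kernels, or one step with q k, after which the m-weighted column sum of the Green
    function is at most m y / b k.+1. *)
Definition mix_gap k : R := w k * c k / (b k.+1 * b k).

Local Open Scope ereal_scope.

Lemma trunc_mix_ge0 K x y : (0 <= trunc_mix K x y)%R.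
Proof. by apply: sumr_ge0 => k _; rewrite mulr_ge0. Qed.

Lemma esum_trunc_mix K x : \esum_(y in [set: X]) (trunc_mix K x y)%:E = (1 - b K)%:E.
Proof.
rewrite /trunc_mix; under eq_esum do rewrite -sumEFin.
rewrite esum_sum; last by move=> y k _ _; rewrite lee_fin mulr_ge0.
transitivity (\sum_(k < K) (w k)%:E).
  apply: eq_bigr => k _; under eq_esum do rewrite EFinM.
  by rewrite esumZl// ?q1 ?mule1// => y; rewrite lee_fin.
rewrite sumEFin; congr _%:E; elim: K => [|K IH]; first by rewrite big_ord0 b0 subrr.
by rewrite big_ord_recr /= IH (bS K); lra.
Qed.

Lemma trunc_mix_le1 K x : \esum_(y in [set: X]) (trunc_mix K x y)%:E <= 1.
Proof. by rewrite esum_trunc_mix lee_fin gerBl ltW. Qed.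

Let PG K := partial_green (trunc_mix K).
Let PG0 K n x y : 0 <= PG K n x y.
Proof. exact: partial_green_ge0 (@trunc_mix_ge0 K) n x y. Qed.
Let PGS K n x y : PG K n.+1 x y =
  ((x == y)%:R)%:E + \esum_(z in [set: X]) ((trunc_mix K x z)%:E * PG K n z y).
Proof. by rewrite /PG partial_greenS//; exact: trunc_mix_ge0. Qed.
Let tm0 K x z a : 0 <= a -> 0 <= (trunc_mix K x z)%:E * a.
Proof. by move=> a0; rewrite mule_ge0// lee_fin trunc_mix_ge0. Qed.

Let mPG0 K n x y : 0 <= (m x)%:E * PG K n x y.
Proof. by rewrite mule_ge0// lee_fin. Qed.

Lemma mass_PG K n y : \esum_(x in [set: X]) ((m x)%:E * PG K n x y) <= (m y / b K)%:E.
Proof.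
elim: n => [|n IH].
  rewrite esum1 ?lee_fin ?divr_ge0// 1?ltW// => x _.
  by rewrite /PG /partial_green big_ord0 mule0.
have split_mPG x : (m x)%:E * PG K n.+1 x y = (m x)%:E * ((x == y)%:R)%:E +
    (m x)%:E * \esum_(z in [set: X]) ((trunc_mix K x z)%:E * PG K n z y).
  by rewrite PGS ge0_muleDr ?lee_fin//; apply: esum_ge0 => z _; exact: tm0.
rewrite (eq_esum (fun x _ => split_mPG x)) esumD; last 2 first.
- by move=> x _; rewrite -EFinM lee_fin mulr_ge0.
- move=> x _; rewrite mule_ge0 ?lee_fin//; apply: esum_ge0 => z _; exact: tm0.
have -> : \esum_(x in [set: X]) ((m x)%:E * ((x == y)%:R)%:E) = (m y)%:E.
  rewrite (esumID [set y]); last by move=> x _; rewrite -EFinM lee_fin mulr_ge0.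
  rewrite !setTI esum_set1; last by rewrite -EFinM lee_fin mulr_ge0.
  by rewrite eqxx mule1 esum1 ?adde0// => x /= /eqP/negbTE ->; rewrite mule0.
have -> : \esum_(x in [set: X])
    ((m x)%:E * \esum_(z in [set: X]) ((trunc_mix K x z)%:E * PG K n z y)) =
    (1 - b K)%:E * \esum_(z in [set: X]) ((m z)%:E * PG K n z y).
  transitivity (\esum_(x in [set: X]) \esum_(z in [set: X])
      ((m z)%:E * PG K n z y * (trunc_mix K z x)%:E)).
    apply: eq_esum => x _; rewrite -esumZl//; last by move=> z; exact: tm0.
    apply: eq_esum => z _; rewrite muleA [RHS]muleAC -!EFinM.
    congr (_%:E * _); rewrite /trunc_mix !mulr_sumr; apply: eq_bigr => k _.
    by rewrite mulrCA q_rev mulrCA.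
  rewrite esum_swap; last by move=> x z; rewrite mule_ge0// lee_fin trunc_mix_ge0.
  have b1 : (0 <= 1 - b K)%R.
    by rewrite -lee_fin -(esum_trunc_mix K y); apply: esum_ge0 => z _; rewrite lee_fin trunc_mix_ge0.
  rewrite -esumZl//; apply: eq_esum => z _; rewrite [RHS]muleC -(esum_trunc_mix K z).
  have PGfin : PG K n z y \is a fin_num.
    rewrite ge0_fin_numE// /PG /partial_green.
    apply: (@le_lt_trans _ _ (\sum_(i < n) 1)).
      by apply: lee_sum => i _; apply: nstep_le1; [exact: trunc_mix_ge0|exact: trunc_mix_le1].
    by rewrite sumEFin ltry.
  rewrite -(fineK PGfin) -EFinM -esumZl//; first by rewrite mulr_ge0// fine_ge0.
  by move=> x; rewrite lee_fin trunc_mix_ge0.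
apply: le_trans (leeD2l _ (lee_wpmul2l _ IH)) _.
  by rewrite lee_fin subr_ge0 -b0; elim: (K) => // K' IHK; rewrite (le_trans _ IHK)// (bS K') lerDr.
rewrite -EFinM -EFinD lee_fin le_eqVlt; apply/orP; left; apply/eqP.
by have := gt_eqF (b_gt0 K) => /negbT bK; field.
Qed.

Lemma gap_ge0 k : (0 <= mix_gap k)%R.
Proof. by rewrite divr_ge0// mulr_ge0// ltW. Qed.

(* The walk with kernel trunc_mix K is killed with probability b K at each step, so
   its Green function has row sums at most 1 / b K and, by reversibility, m-weighted
   column sums at most m y / b K; mix_gap K bounds the trajectories that use q K. *)
Lemma PG_step K n x y : PG K.+1 n x y <= PG K n x y + (m y * mix_gap K)%:E.
Proof.
elim: n x => [|n IH] x.
  by rewrite /PG /partial_green !big_ord0 add0e lee_fin mulr_ge0// gap_ge0.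
rewrite !PGS -addeA leeD2l//.
have -> : \esum_(z in [set: X]) ((trunc_mix K.+1 x z)%:E * PG K.+1 n z y) =
    \esum_(z in [set: X]) ((trunc_mix K x z)%:E * PG K.+1 n z y) +
    \esum_(z in [set: X]) ((w K * q K x z)%:E * PG K.+1 n z y).
  rewrite -esumD; last 2 first.
  - by move=> z _; exact: tm0.
  - by move=> z _; rewrite mule_ge0// lee_fin mulr_ge0.
  apply: eq_esum => z _; rewrite -ge0_muleDl ?lee_fin ?trunc_mix_ge0 ?mulr_ge0//.
  by rewrite /trunc_mix big_ord_recr.
have h1 : \esum_(z in [set: X]) ((trunc_mix K x z)%:E * PG K.+1 n z y) <=
    \esum_(z in [set: X]) ((trunc_mix K x z)%:E * PG K n z y) +
    ((1 - b K) * (m y * mix_gap K))%:E.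
  rewrite EFinM -(esum_trunc_mix K x) [X in _ + X]muleC -esumZl; last 2 first.
  - by rewrite mulr_ge0// gap_ge0.
  - by move=> z; rewrite lee_fin trunc_mix_ge0.
  rewrite -esumD; last 2 first.
  - by move=> z _; exact: tm0.
  - move=> z _; rewrite -EFinM lee_fin; apply: mulr_ge0; last exact: trunc_mix_ge0.
    by apply: mulr_ge0 => //; exact: gap_ge0.
  apply: le_esum => z _; rewrite [X in _ + X]muleC -ge0_muleDr//; last first.
    by rewrite lee_fin mulr_ge0// gap_ge0.
  by apply: lee_wpmul2l; rewrite ?lee_fin ?trunc_mix_ge0//; exact: IH.
have h2 : \esum_(z in [set: X]) ((w K * q K x z)%:E * PG K.+1 n z y) <=
    (w K * c K * (m y / b K.+1))%:E.
  have wc : (0 <= w K * c K)%R by rewrite mulr_ge0.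
  apply: (@le_trans _ _ ((w K * c K)%:E * \esum_(z in [set: X]) ((m z)%:E * PG K.+1 n z y))).
    rewrite -esumZl//; apply: le_esum => z _; rewrite muleA; apply: lee_wpmul2r => //.
    by rewrite -EFinM lee_fin -mulrA ler_wpM2l.
  rewrite [leRHS]EFinM; apply: lee_wpmul2l; first by rewrite lee_fin.
  exact: mass_PG.
apply: le_trans (leeD h1 h2) _; rewrite -addeA leeD2l// -EFinD lee_fin.
rewrite le_eqVlt; apply/orP; left; apply/eqP; rewrite /mix_gap.
by field; rewrite !gt_eqF.
Qed.

Lemma PG_bound K n x y :
  PG K n x y <= ((x == y)%:R + m y * \sum_(k < K) mix_gap k)%:E.
Proof.
elim: K => [|K IH].
  rewrite big_ord0 mulr0 addr0; case: n => [|n].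
    by rewrite /PG /partial_green big_ord0 lee_fin; case: (x == y).
  rewrite PGS esum1 ?adde0// => z _.
  by rewrite /trunc_mix big_ord0 mul0e.
apply: le_trans (PG_step _ _ _ _) _; rewrite big_ord_recr /= mulrDr addrA EFinD.
exact: leeD2r.
Qed.

Let p0 x y : (0 <= p x y)%R.
Proof. exact: le_trans (trunc_mix_ge0 0 x y) (p_ge 0 x y). Qed.
Let p1' x : \esum_(y in [set: X]) (p x y)%:E <= 1.
Proof. by rewrite p1. Qed.

(** That p is the limit of the truncated mixtures enters in this form alone: p dominates each of
    them and has total mass 1, so what is missing has mass b K. *)
Lemma esum_remainder K x : \esum_(z in [set: X]) (p x z - trunc_mix K x z)%:E = (b K)%:E.
Proof.
have : \esum_(z in [set: X]) (p x z)%:E =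
    \esum_(z in [set: X]) (trunc_mix K x z)%:E +
    \esum_(z in [set: X]) (p x z - trunc_mix K x z)%:E.
  rewrite -esumD; last 2 first.
  - by move=> z _; rewrite lee_fin trunc_mix_ge0.
  - by move=> z _; rewrite lee_fin subr_ge0.
  by apply: eq_esum => z _; rewrite -EFinD addrC subrK.
rewrite p1 esum_trunc_mix.
case: (\esum_(z in [set: X]) (p x z - trunc_mix K x z)%:E) => //= r [].
by move=> /eqP; rewrite -subr_eq => /eqP h; congr _%:E; lra.
Qed.

(** At each step the two kernels differ by mass b K, which affects at most n later terms. The
    quadratic loss in n is harmless: n is fixed when K tends to infinity. *)
Lemma partial_green_tail K n x y :
  partial_green p n x y <= PG K n x y + ((n * n)%:R * b K)%:E.
Proof.
elim: n x => [|n IH] x.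
  by rewrite /PG /partial_green !big_ord0 add0e lee_fin mul0r.
rewrite partial_greenS// PGS -addeA leeD2l//.
have pg0 z : 0 <= partial_green p n z y by apply: partial_green_ge0.
have r0 z : (0 <= p x z - trunc_mix K x z)%R by rewrite subr_ge0.
have -> : \esum_(z in [set: X]) ((p x z)%:E * partial_green p n z y) =
    \esum_(z in [set: X]) ((trunc_mix K x z)%:E * partial_green p n z y) +
    \esum_(z in [set: X]) ((p x z - trunc_mix K x z)%:E * partial_green p n z y).
  rewrite -esumD; last 2 first.
  - by move=> z _; exact: tm0.
  - by move=> z _; rewrite mule_ge0// lee_fin.
  apply: eq_esum => z _; rewrite -ge0_muleDl ?lee_fin ?trunc_mix_ge0//.
  by rewrite -EFinD addrC subrK.
have h1 : \esum_(z in [set: X]) ((trunc_mix K x z)%:E * partial_green p n z y) <=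
    \esum_(z in [set: X]) ((trunc_mix K x z)%:E * PG K n z y) +
    ((n * n)%:R * b K)%:E.
  apply: (@le_trans _ _ (\esum_(z in [set: X]) ((trunc_mix K x z)%:E * PG K n z y) +
     ((n * n)%:R * b K)%:E * \esum_(z in [set: X]) (trunc_mix K x z)%:E)).
    rewrite -esumZl; last 2 first.
    - by rewrite mulr_ge0// ltW.
    - by move=> z; rewrite lee_fin trunc_mix_ge0.
    rewrite -esumD; last 2 first.
    - by move=> z _; exact: tm0.
    - move=> z _; rewrite -EFinM lee_fin; apply: mulr_ge0; last exact: trunc_mix_ge0.
      by apply: mulr_ge0 => //; exact: ltW.
    apply: le_esum => z _; rewrite [X in _ + X]muleC -ge0_muleDr//; last first.
      by rewrite lee_fin mulr_ge0// ltW.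
    by apply: lee_wpmul2l; rewrite ?lee_fin ?trunc_mix_ge0//; exact: IH.
  apply: leeD2l; rewrite -[leRHS]mule1; apply: lee_wpmul2l.
    by rewrite lee_fin mulr_ge0// ltW.
  exact: trunc_mix_le1.
have h2 : \esum_(z in [set: X]) ((p x z - trunc_mix K x z)%:E * partial_green p n z y) <=
    (n%:R * b K)%:E.
  rewrite EFinM -(esum_remainder K x) -esumZl//.
  apply: le_esum => z _; rewrite muleC; apply: lee_wpmul2r; first by rewrite lee_fin.
  rewrite /partial_green; apply: (@le_trans _ _ (\sum_(i < n) 1)).
    by apply: lee_sum => i _; apply: nstep_le1.
  by rewrite sumEFin sumr_const card_ord.
apply: le_trans (leeD h1 h2) _; rewrite -addeA leeD2l// -EFinD lee_fin -mulrDl.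
apply: ler_wpM2r; first exact: ltW.
by rewrite -natrD ler_nat; lia.
Qed.

Theorem mixture_green (C : R) x y : (forall K, \sum_(k < K) mix_gap k <= C)%R ->
  green p x y <= ((x == y)%:R + m y * C)%:E.
Proof.
move=> gapC; apply: green_le => // n; apply/lee_addgt0Pr => e e0.
have [K bK] : exists K, (b K < e / (n * n).+1%:R)%R.
  by apply: b_small; rewrite divr_gt0.
apply: le_trans (partial_green_tail K n x y) _.
apply: leeD.
  apply: le_trans (PG_bound _ _ _ _) _; rewrite lee_fin lerD2l ler_wpM2l//.
rewrite lee_fin; move: bK; rewrite ltr_pdivlMr// => bK; apply: le_trans (ltW bK).
rewrite mulrC; apply: ler_wpM2l; first exact: ltW.
by rewrite ler_nat.
Qed.

End Mixture.

(** * Growth of groups *)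

Section Balls.
Local Open Scope nat_scope.
Variables (G : groupType) (s : seq G).

Fixpoint ball_seq (r : nat) : seq G :=
  if r is r'.+1 then
    undup [seq (x * y)%g | x <- 1%g :: s, y <- ball_seq r']
  else [:: 1%g].

Lemma ball_seq_uniq r : uniq (ball_seq r).
Proof. by case: r => // r; exact: undup_uniq. Qed.

Lemma ball_seqS r x y :
  x \in 1%g :: s -> y \in ball_seq r -> (x * y)%g \in ball_seq r.+1.
Proof. by move=> xs yr; rewrite mem_undup; apply/allpairsP; exists (x, y). Qed.

Lemma ball_seqSP r g : g \in ball_seq r.+1 ->
  exists x y, [/\ x \in 1%g :: s, y \in ball_seq r & g = (x * y)%g].
Proof. by rewrite mem_undup => /allpairsP[[x y]/= [? ? ->]]; exists x, y. Qed.

Lemma ball_seq_step r g : g \in ball_seq r -> g \in ball_seq r.+1.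
Proof.
by move=> gr; rewrite -[g]mul1g; apply: ball_seqS => //; rewrite mem_head.
Qed.

Lemma ball_seq_le r r' g : r <= r' -> g \in ball_seq r -> g \in ball_seq r'.
Proof.
by move=> /subnK <-; elim: (r' - r) => // n IH /IH; exact: ball_seq_step.
Qed.

Lemma one_ball_seq r : 1%g \in ball_seq r.
Proof. by apply: (@ball_seq_le 0) => //; rewrite mem_head. Qed.

Lemma ball_seqM r r' g h :
  g \in ball_seq r -> h \in ball_seq r' -> (g * h)%g \in ball_seq (r + r').
Proof.
move=> + hr'; elim: r g => [|r IH] g.
  by rewrite inE => /eqP ->; rewrite mul1g.
move=> /ball_seqSP[x [y [xs yr ->]]]; rewrite -mulgA addSn.
exact: ball_seqS (IH _ yr).
Qed.

Lemma ball_seqX r g n : g \in ball_seq r -> (g ^+ n)%g \in ball_seq (r * n).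
Proof.
move=> gr; elim: n => [|n IH]; first by rewrite expg0 one_ball_seq.
by rewrite expgS mulnS; exact: ball_seqM.
Qed.

Lemma gen_ball_seq x : x \in s -> x \in ball_seq 1.
Proof. by move=> xs; rewrite -[x]mulg1; apply: ball_seqS; rewrite ?inE ?xs ?orbT. Qed.

Lemma ball_seqV r g : {in s, forall x, (x^-1)%g \in s} ->
  g \in ball_seq r -> (g^-1)%g \in ball_seq r.
Proof.
move=> sV; elim: r g => [|r IH] g; first by rewrite !inE => /eqP ->; rewrite invg1.
move=> /ball_seqSP[x [y [xs yr ->]]]; rewrite invgM -addn1.
apply: ball_seqM; first exact: IH.
by move: xs; rewrite inE => /predU1P[->|/sV/gen_ball_seq//]; rewrite invg1 one_ball_seq.
Qed.

Lemma size_ball_seq r : size (ball_seq r) <= (size s).+1 ^ r.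
Proof.
elim: r => // r IH; rewrite expnS; apply: leq_trans (size_undup _) _.
by rewrite size_allpairs leq_mul2l IH orbT.
Qed.

Lemma ball_seq_gen : {in s, forall x, (x^-1)%g \in s} ->
  generated [set` s] = setT -> forall g, exists r, g \in ball_seq r.
Proof.
move=> sV sT g; have : generated [set` s] g by rewrite sT.
move=> /(_ [set g | exists r, g \in ball_seq r]); apply; last by move=> x xs; exists 1; exact: gen_ball_seq.
split; first by exists 0; exact: one_ball_seq.
  by move=> x y [r xr] [r' yr']; exists (r + r'); exact: ball_seqM.
by move=> x [r xr]; exists r; exact: ball_seqV.
Qed.

(** * Words in the generators and shortlex-minimal representatives *)

Notation letter := 'I_(size s).
Implicit Types w u v : seq letter.

Definition eval w : G := foldr (fun (i : letter) g => (nth 1%g s i * g)%g) 1%g w.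

Lemma eval_cat u v : eval (u ++ v) = (eval u * eval v)%g.
Proof. by elim: u => [|i u IH] /=; rewrite ?mul1g // IH mulgA. Qed.

Lemma eval_ball_seq w : eval w \in ball_seq (size w).
Proof.
elim: w => [|i w IH]; first exact: one_ball_seq.
by apply: ball_seqS => //; rewrite inE mem_nth ?orbT.
Qed.

Lemma ball_seq_eval r g : g \in ball_seq r ->
  exists2 w, eval w = g & size w <= r.
Proof.
elim: r g => [|r IH] g; first by rewrite inE => /eqP ->; exists [::].
move=> /ball_seqSP[x [y [+ /IH[w <- wr] ->]]].
rewrite inE => /predU1P[->|xs]; first by exists w; rewrite ?mul1g// ltnW.
have ix : index x s < size s by rewrite index_mem.
by exists (Ordinal ix :: w) => //=; rewrite nth_index.
Qed.

(* Digits 1, ..., k in base k + 1: comparing codes is the shortlex order. *)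
Definition code w : nat :=
  foldl (fun n (i : letter) => n * (size s).+1 + i.+1) 0 w.

Lemma code_cat u v : code (u ++ v) = code u * (size s).+1 ^ size v + code v.
Proof.
rewrite /code foldl_cat; elim/last_ind: v => [|v i IH] /=; first by rewrite muln1 addn0.
by rewrite !foldl_rcons IH size_rcons expnS; lia.
Qed.

Lemma code_rcons w i : code (rcons w i) = code w * (size s).+1 + i.+1.
Proof. by rewrite /code foldl_rcons. Qed.

Lemma code_lt w : code w < (size s).+1 ^ size w.
Proof.
elim/last_ind: w => // w i IH; rewrite code_rcons size_rcons expnSr.
have := ltn_ord i; nia.
Qed.

Lemma code_ge i w : (size s).+1 ^ size w <= code (i :: w).
Proof. by rewrite -cat1s code_cat /= /code /=; nia. Qed.

Lemma code_size u v : code u <= code v -> size u <= size v.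
Proof.
case: u => [|i u] uv //=; rewrite ltnNge; apply/negP => vu.
have := code_ge i u; have := code_lt v.
have : (size s).+1 ^ size v <= (size s).+1 ^ size u by rewrite leq_pexp2l.
lia.
Qed.

Lemma code_inj : injective code.
Proof.
elim/last_ind=> [|u i IH] v; elim/last_ind: v => [|v j _] //; rewrite ?code_rcons.
- by rewrite /code/=; lia.
- by rewrite /code/=; lia.
move=> e; have /(congr1 (modn^~ (size s).+1)) := e.
rewrite !modnMDl !modn_small ?ltnS// => -[ij].
have {}ij : i = j by apply: val_inj.
by move: e; rewrite ij => /eqP; rewrite eqn_add2r eqn_mul2r /= => /eqP/IH ->.
Qed.

Definition minimal w : Prop := forall w', eval w' = eval w -> code w <= code w'.

Lemma minimalP r g : g \in ball_seq r ->
  exists w, [/\ minimal w, eval w = g & size w <= r].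
Proof.
move=> /ball_seq_eval[w0 ew0 w0r].
have ex : exists n, `[< exists2 w, eval w = g & code w = n >].
  by exists (code w0); apply/asboolP; exists w0.
case: (ex_minnP ex) => n /asboolP[w ew cw] nmin; exists w; split=> //.
  by move=> w' ew'; rewrite cw; apply: nmin; apply/asboolP; exists w'; rewrite ?ew'.
apply: leq_trans w0r; apply: code_size; rewrite cw; apply: nmin.
by apply/asboolP; exists w0.
Qed.

(** A representative of the factor with smaller code is not longer than it, so substituting it
    lowers the code of the whole word without changing its value. *)
Lemma minimal_factor u v w : minimal (u ++ v ++ w) -> minimal v.
Proof.
move=> uvw v' ev; rewrite leqNgt; apply/negP => lt.
have /uvw : eval (u ++ v' ++ w) = eval (u ++ v ++ w) by rewrite !eval_cat ev.
rewrite !code_cat !size_cat.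
have : (size s).+1 ^ (size v' + size w) <= (size s).+1 ^ (size v + size w).
  by rewrite leq_pexp2l// leq_add2r code_size// ltnW.
have : code v'* (size s).+1 ^ size w < code v * (size s).+1 ^ size w.
  by rewrite ltn_mul2r lt expn_gt0.
nia.
Qed.

Lemma minimal_inj u v : minimal u -> minimal v -> eval u = eval v -> u = v.
Proof.
move=> mu mv e; apply: code_inj; apply/eqP; rewrite eqn_leq.
by rewrite mu ?mv.
Qed.

Lemma minimal_eval1 w : minimal w -> eval w = 1%g -> w = [::].
Proof. by move=> mw ew; apply: minimal_inj => // w' _. Qed.

End Balls.

Section Growth.
Local Open Scope nat_scope.
Variables (G : groupType) (s : seq G).
Hypothesis sV : {in s, forall x, (x^-1)%g \in s}.
Hypothesis sG : generated [set` s] = setT.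

Let ball_ex := ball_seq_gen sV sG.

Definition fac (T : Type) (w : seq T) m i := take m (drop i w).

Lemma fac_cat (T : Type) (w : seq T) m i :
  w = take i w ++ fac w m i ++ drop m (drop i w).
Proof. by rewrite cat_take_drop cat_take_drop. Qed.

Lemma fac_behead (T : Type) (w : seq T) m i : behead (fac w m.+1 i) = fac w m i.+1.
Proof. rewrite /fac -[i.+1]add1n -drop_drop drop1; by case: (drop i w). Qed.

Lemma fac_trunc (T : Type) (w : seq T) m i : take m (fac w m.+1 i) = fac w m i.
Proof. by rewrite /fac; elim: (drop i w) m => [|a v IH] [|m] //=; rewrite IH. Qed.

Lemma size_fac (T : Type) (w : seq T) m i : m + i <= size w -> size (fac w m i) = m.
Proof. by move=> mi; rewrite size_takel// size_drop; lia. Qed.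

(** In the language of factor complexity: no factor of length m seen at the first n positions is
    right special. *)
Definition deterministic (T : Type) (w : seq T) (n m : nat) :=
  forall i j, i < n -> j < n -> fac w m i = fac w m j -> fac w m.+1 i = fac w m.+1 j.

Definition factors (T : eqType) (w : seq T) n m := undup [seq fac w m i | i <- iota 0 n].

(** Truncation maps the factors of length m+1 onto those of length m. If their number does not grow,
    truncation is injective, that is, each factor of length m has a single continuation. *)
Lemma factors_grow (T : eqType) (w : seq T) n m : ~ deterministic w n m ->
  size (factors w n m) < size (factors w n m.+1).
Proof.
move=> nd; rewrite ltnNge; apply/negP => le; apply: nd => i j ni nj eij.
set A := factors w n m.+1.
have sub : {subset factors w n m <= [seq take m v | v <- A]}.
  move=> v; rewrite mem_undup => /mapP[k kn ->]; apply/mapP; exists (fac w m.+1 k).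
    by rewrite mem_undup; apply: map_f.
  by rewrite fac_trunc.
have uA : uniq [seq take m v | v <- A].
  by apply: leq_size_uniq sub _; rewrite ?undup_uniq// size_map; exact: le.
have inA k : k < n -> fac w m.+1 k \in A.
  by move=> kn; rewrite mem_undup map_f// mem_iota.
have inj x y : x \in A -> y \in A -> take m x = take m y -> x = y.
  elim: (A) uA => //= a A' IH /andP[aA' uA']; rewrite !inE.
  move=> /predU1P[->|xA] /predU1P[->|yA] // e.
  - by rewrite e map_f in aA'.
  - by rewrite -e map_f in aA'.
  - exact: IH.
by apply: inj; rewrite ?inA// !fac_trunc.
Qed.

Lemma factors_size (T : eqType) (w : seq T) n r : 0 < n ->
  (forall m, m < r -> ~ deterministic w n m) ->
  forall m, m <= r -> m < size (factors w n m).
Proof.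
move=> n0 nd; elim=> [|m IH] mr.
  have : fac w 0 0 \in factors w n 0 by rewrite mem_undup map_f// mem_iota.
  by case: factors.
exact: leq_ltn_trans (IH (ltnW mr)) (factors_grow (nd _ mr)).
Qed.

Lemma exponent_seq (A : seq G) : (forall g : G, exists2 q, 0 < q & (g ^+ q)%g = 1%g) ->
  exists2 q, 0 < q & {in A, forall g, (g ^+ q)%g = 1%g}.
Proof.
move=> tor; elim: A => [|a A [q q0 Aq]]; first by exists 1.
have [q' q'0 aq'] := tor a; exists (q' * q); first by rewrite muln_gt0 q'0.
move=> g; rewrite inE => /predU1P[->|gA]; first by rewrite expgnA aq' expg1n.
by rewrite mulnC expgnA Aq// expg1n.
Qed.

Lemma minimal_long L : (forall r, exists g, g \notin ball_seq s r) ->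
  exists2 w : seq 'I_(size s), minimal w & L <= size w.
Proof.
move=> inf; have [g gL] := inf L; have [r gr] := ball_ex g.
have [w [mw ew _]] := minimalP gr; exists w => //.
rewrite leqNgt; apply/negP => wL; move/negP: gL; apply; rewrite -ew.
exact: ball_seq_le (ltnW wL) (eval_ball_seq _).
Qed.

Lemma fac_minimal (w : seq 'I_(size s)) m i : minimal w -> minimal (fac w m i).
Proof. by rewrite {1}(fac_cat w m i) => /minimal_factor. Qed.

Lemma eval_fac_ball (w : seq 'I_(size s)) m i r : m <= r ->
  eval (fac w m i) \in ball_seq s r.
Proof.
move=> mr; apply: ball_seq_le (eval_ball_seq _).
by rewrite size_take_min; apply: leq_trans mr; exact: geq_minl.
Qed.

(** Determinism carries the coincidence at i and j forward one letter at a time, so w has period j -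
    i from position i + m on, as far as the first n positions reach. *)
Lemma deterministic_periodic (T : eqType) (w : seq T) n m i j :
  deterministic w n m -> n + m <= size w -> i < j -> fac w m i = fac w m j ->
  forall L, j + L <= n -> fac w L (i + m) = fac w L (j + m).
Proof.
move=> det nw ij eij.
have prop t : j + t < n -> fac w m (i + t) = fac w m (j + t).
  elim: t => [|t IH] jt; first by rewrite !addn0.
  rewrite !addnS -!fac_behead; congr behead; apply: det; last apply: IH; lia.
move=> L jL; case: w => [|x0 w'] in det nw eij prop *.
  by rewrite /fac; case: L {jL}.
set w := x0 :: w' in det nw eij prop *.
have szf a : a + L <= size w -> size (fac w L a) = L.
  by move=> aL; rewrite size_takel// size_drop; lia.
apply: (@eq_from_nth _ x0); first by rewrite !szf//; lia.
move=> t; rewrite szf; last by lia.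
move=> tL; rewrite !nth_take// !nth_drop.
have /(congr1 (nth x0 ^~ m)) : fac w m.+1 (i + t) = fac w m.+1 (j + t).
  by apply: det; [lia|lia|apply: prop; lia].
by rewrite !nth_take// !nth_drop !(addnAC _ t m).
Qed.

(* Morse--Hedlund: a word with at most m factors of some length m is eventually
   periodic, which a long shortlex-minimal word over a torsion group is not. *)
Lemma torsion_growth :
  (forall g : G, exists2 q, 0 < q & (g ^+ q)%g = 1%g) ->
  (forall r, exists g, g \notin ball_seq s r) ->
  forall r, r * r <= 2 * size (ball_seq s r).
Proof.
move=> tor inf r; set K := size (ball_seq s r).
have [q q0 qK] := exponent_seq (ball_seq s K) tor.
(* Among the positions 0, ..., K two factors of length less than r must have the same value, as the
   ball has K elements. The period is then at most K, and q periods still fit after the second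
   position. *)
pose n := (K + K * q).+1.
have [w mw nw] := minimal_long (n + r) inf.
have [[m mr det]|nd] := pselect (exists2 m, m < r & deterministic w n m); last first.
  have szF : forall m, m <= r -> m < size (factors w n m).
    by apply: factors_size => // m mr det; apply: nd; exists m.
  have mF m v : v \in factors w n m -> exists i, [/\ v = fac w m i & i < n].
    by rewrite mem_undup => /mapP[i]; rewrite mem_iota => /= ni ->; exists i.
  have szv m v : m <= r -> v \in factors w n m -> size v = m /\ minimal v.
    move=> mr /mF[i [-> ni]]; split; last exact: fac_minimal.
    by apply: size_fac; apply: leq_trans nw; lia.
  (* With no deterministic length there are at least m + 1 factors of each length m < t, all
     minimal; altogether at least t (t + 1) / 2 words, on which [eval] is injective. *)
  have main t : t <= r -> exists A : seq (seq 'I_(size s)),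
      [/\ uniq A, t * t.+1 <= 2 * size A & forall v, v \in A -> size v < t /\ minimal v].
    elim: t => [|t IH] tr; first by exists [::].
    have [A [uA szA Av]] := IH (ltnW tr); exists (A ++ factors w n t); split.
    - rewrite cat_uniq uA undup_uniq andbT /=; apply/hasPn => v /(szv _ _ (ltnW tr))[vt _].
      by apply/negP => /Av[]; rewrite vt ltnn.
    - have -> : t.+1 * t.+2 = t * t.+1 + 2 * t.+1 by lia.
      by rewrite size_cat mulnDr leq_add// leq_mul2l/= szF// ltnW.
    - move=> v; rewrite mem_cat => /orP[/Av[vt mv]|/(szv _ _ (ltnW tr))[-> mv]] //.
      by split => //; apply: ltnW.
  have [A [uA szA Av]] := main r (leqnn r).
  suff AK : size A <= K.
    by apply: leq_trans (leq_mul (leqnn 2) AK); apply: leq_trans szA; lia.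
  rewrite -(size_map (@eval G s)); apply: uniq_leq_size.
    rewrite map_inj_in_uniq// => u v uA' vA' e.
    by apply: minimal_inj e; [case: (Av u uA')|case: (Av v vA')].
  move=> g /mapP[v vA ->]; apply: ball_seq_le (eval_ball_seq _).
  by apply: ltnW; case: (Av v vA).
exfalso.
pose fs := [seq eval (fac w m i) | i <- iota 0 K.+1].
have : ~~ uniq fs.
  apply/negP => ufs.
  have : size fs <= K.
    by apply: uniq_leq_size => // g /mapP[i _ ->]; apply: eval_fac_ball; exact: ltnW.
  by rewrite size_map size_iota ltnn.
move=> /(uniqPn 1%g)[i [j [ij]]]; rewrite size_map size_iota => jK.
rewrite !(nth_map 0) ?size_iota ?(ltn_trans ij)// !nth_iota ?(ltn_trans ij)// !add0n => eij.
have {}eij : fac w m i = fac w m j by apply: minimal_inj eij; exact: fac_minimal.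
have per := deterministic_periodic det (leq_trans _ nw) ij eij.
have {}per L : j + L <= n -> fac w L (i + m) = fac w L (j + m) by apply: per; lia.
pose d := j - i; pose u := eval (fac w d (i + m)).
(* A nonempty factor of w is thus a q-th power u^q. Its value is 1 by the choice of q, whereas the
   only minimal word with value 1 is empty. *)
have up p : j + d * p <= n -> eval (fac w (d * p) (i + m)) = (u ^+ p)%g.
  elim: p => [|p IH] jp; first by rewrite muln0 /fac take0 expg0.
  have {}jp : j + d + d * p <= n by rewrite -addnA -mulnS.
  rewrite mulnS /fac takeD eval_cat expgS; congr (_ * _)%g.
  rewrite -IH; last by lia.
  rewrite drop_drop; have -> : d + (i + m) = j + m by rewrite /d; lia.
  by rewrite -/(fac _ _ _) -per//; lia.
have dK : d <= K by rewrite /d; lia.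
have dq : d * q <= K * q by rewrite leq_mul2r dK orbT.
have uq : (u ^+ q)%g = 1%g.
  by apply: qK; exact: eval_fac_ball.
have jdq : j + d * q <= n by rewrite /n; lia.
have := minimal_eval1 (@fac_minimal w (d * q) (i + m) mw); rewrite up// uq => /(_ erefl).
move=> /(congr1 size); rewrite size_fac; last by apply: leq_trans nw; rewrite /n; lia.
by rewrite /= /d; nia.
Qed.

(** The ball of radius r meets r + 1 distinct left cosets of the subgroup generated by u, and r + 1
    powers of u are available in each of them. *)
Lemma infinite_order_growth (u : G) a :
  (forall q, 0 < q -> (u ^+ q)%g <> 1%g) -> u \in ball_seq s a ->
  ~ finite_index_in (generated [set u]) [set: G] ->
  forall r, r * r <= size (ball_seq s (r + a * r)).
Proof.
move=> uinf ua nfin r; set K := generated [set u].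
have Ksub : is_subgroup K.
  split=> [L [] // | x y Kx Ky L Ls uL | x Kx L Ls uL].
  - by case: (Ls) => _ LM _; apply: LM; [exact: Kx|exact: Ky].
  - by case: (Ls) => _ _ LV; apply: LV; exact: Kx.
have Ku : K u by move=> L _; apply.
have KX n : K (u ^+ n)%g.
  case: Ksub => K1 KM _; elim: n => [|n IH]; first by rewrite expg0.
  by rewrite expgS; exact: KM.
(* If the next ball met no coset besides those represented in F, their union would be stable under
   left multiplication by the generators, hence all of G, and K would have finite index. *)
have cosets t : exists F : seq G, [/\ size F = t.+1, {subset F <= ball_seq s t} &
    forall i j, i < j -> j <= t -> ~ K ((nth 1%g F i)^-1 * nth 1%g F j)%g].
  elim: t => [|t [F [szF Ft KF]]].
    by exists [:: 1%g]; split=> //; move=> i [|j].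
  have [[b bt Fb]|all] := pselect (exists2 b, b \in ball_seq s t.+1 &
      forall i, i <= t -> ~ K ((nth 1%g F i)^-1 * b)%g).
    exists (rcons F b); split; first by rewrite size_rcons szF.
      move=> x; rewrite mem_rcons inE => /predU1P[->//|/Ft]; exact: ball_seq_step.
    move=> i j ij; rewrite leq_eqVlt => /predU1P[jt|jt]; last first.
      by rewrite !nth_rcons szF jt (ltn_trans ij jt); apply: KF.
    rewrite !nth_rcons szF -jt ij jt ltnn eqxx; apply: Fb; lia.
  exfalso; apply: nfin; split=> //; exists [set` F]; first exact: finite_seq.
  have near b : b \in ball_seq s t.+1 -> exists2 f, f \in F & K (f^-1 * b)%g.
    move=> bt; apply: contrapT => nf; apply: all; exists b => // i it Ki.
    by apply: nf; exists (nth 1%g F i) => //; rewrite mem_nth// szF.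
  move=> h _; have [n hn] := ball_ex h; elim: n h hn => [|n IH] h.
    by rewrite inE => /eqP ->; apply: near; exact: one_ball_seq.
  move=> /ball_seqSP[x [y [xs /IH[f Ff Kf] ->]]].
  have [f' Ff' Kf'] : exists2 f', f' \in F & K (f'^-1 * (x * f))%g.
    by apply: near; apply: ball_seqS => //; exact: Ft.
  exists f' => //; case: Ksub => _ KM _; have := KM _ _ Kf' Kf.
  by rewrite !mulgA mulgK.
have [F [szF Fr KF]] := cosets r.
pose A := [seq (f * u ^+ k)%g | f <- F, k <- iota 0 r.+1].
have cosetF i j : i <= r -> j <= r -> K ((nth 1%g F i)^-1 * nth 1%g F j)%g -> i = j.
  move=> ir jr Kij; case: (ltngtP i j) => // ij; first by case: (KF _ _ ij jr).
  case: (KF _ _ ij ir); case: Ksub => _ _ KV; have := KV _ Kij.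
  by rewrite invgM invgK.
have uF : uniq F.
  apply/(uniqP 1%g) => i j; rewrite !inE szF !ltnS => ir jr e; apply: cosetF => //.
  by rewrite e mulVg; case: Ksub.
have uXinj k k' : (u ^+ k)%g = (u ^+ k')%g -> k = k'.
  wlog kk : k k' / k <= k' => [th|].
    by case: (leqP k k') => [|/ltnW] h e; [exact: th|apply/esym/th].
  move=> e; apply/eqP; rewrite eqn_leq kk leqNgt; apply/negP => lt.
  apply: (uinf (k' - k)); first by rewrite subn_gt0.
  by apply: (mulgI (u ^+ k)%g); rewrite -expgnDr subnKC// mulg1 e.
have uA : uniq A.
  apply: allpairs_uniq => //; first exact: iota_uniq.
  move=> [f k] [f' k'] /allpairsP[[? ?] [fF kr [ef ek]]].
  move=> /allpairsP[[? ?] [f'F k'r [ef' ek']]] /= e.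
  move: fF f'F => /=; rewrite -{}ef -{}ef' => fF f'F.
  have ff : f = f'.
    move: (fF) (f'F) => /(nthP 1%g)[i ir fi] /(nthP 1%g)[j jr fj].
    move: ir jr; rewrite szF !ltnS => ir jr.
    rewrite -fi -fj; congr nth; apply: cosetF => //; rewrite fi fj.
    have -> : (f^-1 * f' = u ^+ k * (u ^+ k')^-1)%g.
      by apply: (mulgI f); rewrite mulgA mulgV mul1g mulgA e mulgK.
    by case: Ksub => _ KM KV; apply: KM => //; exact: KV.
  by move: e; rewrite ff => /mulgI/uXinj ->.
apply: (@leq_trans (size A)); first by rewrite size_allpairs szF size_iota; nia.
apply: uniq_leq_size uA _ => _ /allpairsP[[f k] [fF + ->]].
rewrite mem_iota /= => kr; apply: ball_seqM; first exact: Fr.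
apply: ball_seq_le (ball_seqX _ ua).
by rewrite leq_mul2l -(ltnS k) kr orbT.
Qed.

(** A single D serves as factor and as dilation of the radius: 2 in the torsion case, one more than
    a length bound for u when u has infinite order. G is infinite because finite groups are
    virtually cyclic. *)
Lemma not_virtually_cyclic_growth : ~ virtually_cyclic [set: G] ->
  exists2 D, 0 < D & forall r, r * r <= D * size (ball_seq s (D * r)).
Proof.
move=> nvc.
have inf r : exists g, g \notin ball_seq s r.
  apply: contrapT => fin; apply: nvc; exists (generated [set 1%g]); last by exists 1%g.
  split=> //; last first.
    exists [set` ball_seq s r]; first exact: finite_seq.
    move=> h _; exists h; last by move=> L [L1 _ _] _; rewrite mulVg.
    by apply: contrapT => hr; apply: fin; exists h; apply/negP.
  split=> [L [] // | x y Kx Ky L Ls uL | x Kx L Ls uL].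
  - by case: (Ls) => _ LM _; apply: LM; [exact: Kx|exact: Ky].
  - by case: (Ls) => _ _ LV; apply: LV; exact: Kx.
have [tor|] := pselect (forall g : G, exists2 q, 0 < q & (g ^+ q)%g = 1%g).
  exists 2 => // r; apply: leq_trans (torsion_growth tor inf r) _.
  rewrite leq_mul2l /=; apply: uniq_leq_size (ball_seq_uniq _ _) _ => g.
  by apply: ball_seq_le; lia.
move=> /existsNP[u utor]; have [a ua] := ball_ex u.
exists a.+1 => // r; rewrite mulSn.
apply: (@leq_trans (size (ball_seq s (r + a * r)))); last by rewrite mulSn leq_addr.
apply: (infinite_order_growth _ ua) => [q q0 uq|fin]; first by apply: utor; exists q.
by apply: nvc; exists (generated [set u]) => //; exists u.
Qed.

End Growth.

(** * The cusped graph *)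

Section GraphDist.
Variables (V : Type) (E : V -> V -> Prop).

Lemma walk_cat n k x y z : walk E n x y -> walk E k y z -> walk E (n + k) x z.
Proof.
by elim: n x => [|n IH] x /=; [move=> ->|move=> [t xt ty] yz; exists t => //; exact: IH yz].
Qed.

Lemma walk_sym n x y : (forall u v, E u v -> E v u) -> walk E n x y -> walk E n y x.
Proof.
move=> Esym; elim: n x => [|n IH] x; first by move=> ->.
move=> [t xt /IH ty]; rewrite -addn1.
by apply: (walk_cat ty); exists x => //; exact: Esym.
Qed.

Lemma walk_map n x y (f : V -> V) : (forall u v, E u v -> E (f u) (f v)) ->
  walk E n x y -> walk E n (f x) (f y).
Proof.
by move=> Ef; elim: n x => [|n IH] x /=; [move=> ->|move=> [t /Ef xt /IH ty]; exists (f t)].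
Qed.

Lemma graph_dist_le n x y : walk E n x y -> (graph_dist E x y <= n)%N.
Proof.
move=> w; rewrite /graph_dist; case: pselect => // ex.
by case: ex_minnP => k _; apply; exact/asboolP.
Qed.

Lemma graph_distP x y : (exists n, walk E n x y) -> walk E (graph_dist E x y) x y.
Proof.
move=> [n w]; rewrite /graph_dist; case: pselect => [ex|[]].
  by case: ex_minnP => k /asboolP.
by exists n; exact/asboolP.
Qed.

Hypothesis E_conn : forall x y, exists n, walk E n x y.

Lemma graph_dist_triangle x y z : (graph_dist E x z <= graph_dist E x y + graph_dist E y z)%N.
Proof. by apply: graph_dist_le; apply: walk_cat (graph_distP _) (graph_distP _). Qed.

Lemma graph_dist_sym x y : (forall u v, E u v -> E v u) ->
  graph_dist E x y = graph_dist E y x.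
Proof.
by move=> Es; apply/eqP; rewrite eqn_leq; apply/andP; split; apply: graph_dist_le;
  apply: walk_sym Es _; exact: graph_distP.
Qed.

Lemma graph_dist_map x y (f : V -> V) : (forall u v, E u v -> E (f u) (f v)) ->
  (graph_dist E (f x) (f y) <= graph_dist E x y)%N.
Proof. by move=> Ef; apply: graph_dist_le; apply: walk_map Ef _; exact: graph_distP. Qed.

End GraphDist.

Section CuspedGeometry.
Variables (R : realType) (G : groupType) (l : nat) (H : 'I_l -> set G).
Hypothesis H_subgroup : forall i, is_subgroup (H i).
Variables (s : seq G) (a : R).
Hypothesis a1 : 1 < a.
Hypothesis sV : {in s, forall x, (x^-1)%g \in s}.
Hypothesis sG : generated [set` s] = setT.

Notation X := (cusped G l).
Notation edge := (@cusped_edge R G l H [set` s] a).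
Notation act := (@cusped_act G l).
Notation rho := (@rho_X R G l H [set` s] a).

Definition base (x : X) : G := match x with inl g => g | inr (_, g, _) => g end.

Definition level (x : X) : option ('I_l * nat) :=
  match x with inl _ => None | inr (i, _, k) => Some (i, k) end.

Definition depth (o : option ('I_l * nat)) : nat := if o is Some (_, k) then k.+1 else 0%N.

Lemma base_act g x : base (act g x) = (g * base x)%g.
Proof. by case: x => [h|[[i h] k]]. Qed.

Lemma level_act g x : level (act g x) = level x.
Proof. by case: x => [h|[[i h] k]]. Qed.

Lemma base_level_inj x y : base x = base y -> level x = level y -> x = y.
Proof.
by case: x => [h|[[i h] k]]; case: y => [h'|[[i' h'] k']] //= -> // [-> ->].
Qed.

Lemma actM g h x : act g (act h x) = act (g * h)%g x.
Proof. by case: x => [k|[[i k] n]] /=; rewrite mulgA. Qed.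

Lemma act1 x : act 1%g x = x.
Proof. by case: x => [k|[[i k] n]] /=; rewrite mul1g. Qed.

Lemma act_vertex g i h n : act g (vertex i h n) = vertex i (g * h)%g n.
Proof. by case: n. Qed.

Lemma edge_sym u v : edge u v -> edge v u.
Proof. by case; [right|left]. Qed.

Lemma edge_act g u v : edge u v -> edge (act g u) (act g v).
Proof.
have arc x y : @cusped_arc R G l H [set` s] a x y ->
    @cusped_arc R G l H [set` s] a (act g x) (act g y).
  case=> [h h' hh'|i h k k' n Hk Hk' kk'|i h k k' n Hk Hk' kk'].
  - by apply: arc_cayley; rewrite /cayley_edge invgM -mulgA mulKg.
  - by rewrite !act_vertex !mulgA; apply: arc_horizontal.
  - by rewrite !act_vertex !mulgA; apply: arc_vertical.
by case=> /arc; [left|right].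
Qed.

Lemma ball_walk r g : g \in ball_seq s r ->
  exists2 n, (n <= r)%N & walk edge n (inl 1%g) (inl g).
Proof.
elim: r g => [|r IH] g; first by rewrite inE => /eqP ->; exists 0%N.
move=> /ball_seqSP[x [y [+ /IH[n nr w] ->]]].
rewrite inE => /predU1P[->|xs]; first by exists n; rewrite ?mul1g// ltnW.
exists n.+1 => //; exists (inl x).
  by left; apply: arc_cayley; rewrite /cayley_edge invg1 mul1g.
by have := walk_map (@edge_act x) w; rewrite /= mulg1.
Qed.

Lemma walk_depth x : walk edge (depth (level x)) (inl (base x)) x.
Proof.
case: x => [h|[[i h] k]] //=.
have step n : edge (vertex i h n) (vertex i h n.+1).
  left; have [H1 _ _] := H_subgroup i.
  rewrite -[h]mulg1; apply: arc_vertical => //.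
  suff -> : word_dist [set` s] 1%g 1%g = 0%N by rewrite exprn_ge0// ltW// (lt_trans _ a1).
  by apply/eqP; rewrite -leqn0; exact: graph_dist_le.
have main n : walk edge n (inl h) (vertex i h n).
  elim: n => // n IH.
  have w1 : walk edge 1 (vertex i h n) (vertex i h n.+1).
    by exists (vertex i h n.+1); first exact: step.
  by have := walk_cat IH w1; rewrite addn1.
exact: (main k.+1).
Qed.

Lemma walk_base g h : exists n, walk edge n (inl g) (inl h).
Proof.
have [r hr] := ball_seq_gen sV sG (g^-1 * h)%g; have [n _ w] := ball_walk hr.
by exists n; have := walk_map (@edge_act g) w; rewrite /= mulg1 mulVKg.
Qed.

Lemma cusped_connected x y : exists n, walk edge n x y.
Proof.
have [n w] := walk_base (base x) (base y).
exists (depth (level x) + n + depth (level y))%N; apply: walk_cat (walk_depth y).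
by apply: walk_cat w; apply: walk_sym (@edge_sym) _; exact: walk_depth.
Qed.

Lemma rho_triangle x y z : rho x z <= rho x y + rho y z.
Proof. by rewrite -natrD ler_nat; exact: graph_dist_triangle cusped_connected _ _ _. Qed.

Lemma rho_sym x y : rho x y = rho y x.
Proof. by congr _%:R; exact: graph_dist_sym cusped_connected _ _ (@edge_sym). Qed.

Lemma rho_act g x y : rho (act g x) (act g y) = rho x y.
Proof.
have le h u v : (graph_dist edge (act h u) (act h v) <= graph_dist edge u v)%N.
  by apply: graph_dist_map; [exact: cusped_connected|exact: edge_act].
congr _%:R; apply/eqP; rewrite eqn_leq le /=.
by have := le (g^-1)%g (act g x) (act g y); rewrite !actM mulVg !act1.
Qed.

Lemma rho_depth x : rho (inl (base x)) x <= (depth (level x))%:R.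
Proof. by rewrite ler_nat; apply: graph_dist_le; exact: walk_depth. Qed.

Lemma rho_base x y : `|rho x y - rho (inl 1%g) (inl ((base x)^-1 * base y)%g)| <=
  (depth (level x))%:R + (depth (level y))%:R.
Proof.
have -> : rho (inl 1%g) (inl ((base x)^-1 * base y)%g) = rho (inl (base x)) (inl (base y)).
  by rewrite -(rho_act (base x)) /= mulg1 mulVKg.
have := rho_depth x; have := rho_depth y.
have := rho_triangle x (inl (base x)) y.
have := rho_triangle (inl (base x)) (inl (base y)) y.
have := rho_triangle (inl (base x)) x (inl (base y)).
have := rho_triangle x y (inl (base y)).
rewrite ler_norml (rho_sym y (inl (base y))) (rho_sym x (inl (base x))).
by move=> *; apply/andP; split; lra.
Qed.

Lemma rho_ball r g : g \in ball_seq s r -> rho (inl 1%g) (inl g) <= r%:R.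
Proof.
by move=> /ball_walk[n nr w]; rewrite ler_nat (leq_trans _ nr)//; exact: graph_dist_le.
Qed.

End CuspedGeometry.

(** * The Markov chain *)

(** A copy of the vertex type with the identity vertex as distinguished point. An increment is a
    step of the chain translated so as to start over the identity: its base is the increment in the
    group, its level the new level. *)
Definition increment (G : groupType) (l : nat) : Type := cusped G l.
HB.instance Definition _ (G : groupType) (l : nat) := Choice.on (increment G l).
HB.instance Definition _ (G : groupType) (l : nat) :=
  isPointed.Build (increment G l) (inl 1%g).

Lemma half_sum (R : realType) n : \sum_(k < n) (2^-1 : R) ^+ k = 2 - 2 * 2^-1 ^+ n.
Proof.
elim: n => [|n IH]; first by rewrite big_ord0 expr0; lra.
by rewrite big_ord_recr /= IH exprS; lra.
Qed.

Lemma esum_half_pickle (R : realType) (T : countType) :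
  (\esum_(t in [set: T]) ((2^-1 : R) ^+ pickle t)%:E <= 2%:E)%E.
Proof.
have h0 k : (0 <= ((2^-1 : R) ^+ k)%:E)%E by rewrite lee_fin exprn_ge0.
rewrite -(esum_image setT pickle (fun k => ((2^-1 : R) ^+ k)%:E)); last first.
  by move=> x y _ _; exact: (pcan_inj pickleK).
apply: (@le_trans _ _ (\esum_(k in [set: nat]) ((2^-1 : R) ^+ k)%:E)%E).
  by rewrite esum_mkcond; apply: le_esum => k _; case: ifP.
rewrite -nneseries_esumT//; apply: lime_le; first exact: is_cvg_nneseries.
apply: nearW => n; rewrite big_mkord sumEFin lee_fin half_sum.
by rewrite gerBl mulr_ge0// exprn_ge0.
Qed.

Lemma esum_seq (R : realType) (T : choiceType) (A : seq T) (F : T -> R) :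
  uniq A -> (forall t, 0 <= F t) ->
  (\esum_(t in [set: T]) ((t \in A)%:R * F t)%:E = (\sum_(t <- A) F t)%:E)%E.
Proof.
move=> uA F0; rewrite -sumEFin fsbig_seq// -esum_fset; last 2 first.
- exact: finite_seq.
- by move=> t _; rewrite lee_fin.
rewrite [RHS]esum_mkcond; apply: eq_esum => t _.
by rewrite mem_setE; case: (t \in A); rewrite ?mul1r ?mul0r.
Qed.

Lemma esum_mulg (R : realType) (G : groupType) (x : G) (F : G -> \bar R) :
  (\esum_(g in [set: G]) F (x * g)%g = \esum_(g in [set: G]) F g)%E.
Proof.
rewrite [RHS](reindex_esum [set: G] _ (fun g => x * g)%g)//.
split=> //; first by move=> g h _ _ /mulgI.
by move=> g _; exists (x^-1 * g)%g; rewrite ?mulVKg.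
Qed.

Section Chain.
Variables (R : realType) (G : groupType) (l : nat) (s : seq G) (D : nat).
Hypothesis sV : {in s, forall x, (x^-1)%g \in s}.
Hypothesis sG : generated [set` s] = setT.
Hypothesis D0 : (0 < D)%N.
Hypothesis growth : forall r, (r * r <= D * size (ball_seq s (D * r)))%N.

Notation X := (cusped G l).
Notation O := (option ('I_l * nat)).

Definition mk (g : G) (o : O) : X := if o is Some (i, k) then inr (i, g, k) else inl g.

Lemma base_mk g o : base (mk g o) = g. Proof. by case: o => [[i k]|]. Qed.
Lemma level_mk g o : level (mk g o) = o. Proof. by case: o => [[i k]|]. Qed.
Lemma mkK x : mk (base x) (level x) = x. Proof. by case: x => [g|[[i g] k]]. Qed.

Lemma esum_cusped (F : X -> \bar R) : (forall x, 0 <= F x)%E ->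
  (\esum_(x in [set: X]) F x = \esum_(g in [set: G]) \esum_(o in [set: O]) F (mk g o))%E.
Proof.
move=> F0; rewrite esum_esum//.
apply: (reindex_esum _ _ (fun z => mk z.1 z.2)); split=> //.
- move=> [g o] [g' o'] _ _ /= e.
  have := congr1 (@base G l) e; have := congr1 (@level G l) e.
  by rewrite !base_mk !level_mk => -> ->.
- by move=> x _; exists (base x, level x); rewrite //= mkK.
Qed.

(** [pickle] makes exponential weights summable over all levels, and [depth] makes the height bound
    the distance to depth zero. The logarithm of a weight is then affine in the height. *)
Definition height (o : O) : nat := (pickle o + depth o)%N.
Definition raw_weight (o : O) : R := 4^-1 ^+ height o.
Definition weight_mass : R := fine (\esum_(o in [set: O]) (raw_weight o)%:E)%E.
Definition weight (o : O) : R := raw_weight o / weight_mass.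

Lemma raw_weight_gt0 o : 0 < raw_weight o.
Proof. by rewrite exprn_gt0. Qed.

Lemma raw_weight_ge0 o : 0 <= raw_weight o.
Proof. exact/ltW/raw_weight_gt0. Qed.
Hint Resolve raw_weight_ge0 : core.

(** One factor 2^-height absorbs 1 + height, the other is summable; this yields both the total mass
    and the finite mean of the height. *)
Lemma raw_weight_le o : raw_weight o * (1 + (height o)%:R) <= 2^-1 ^+ pickle o.
Proof.
rewrite /raw_weight /height; move: (pickle o) (depth o) => n k.
have bern j : 1 + j%:R <= 2 ^+ j :> R.
  elim: j => [|j IH]; first by rewrite addr0 expr0.
  rewrite exprS -[X in 1 + X]natr1 addrA.
  have : 1 <= 2 ^+ j :> R by rewrite exprn_ege1// ler1n.
  by move: IH; lra.
apply: (@le_trans _ _ (4^-1 ^+ (n + k) * 2 ^+ (n + k))).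
  by rewrite ler_wpM2l// exprn_ge0.
rewrite -exprMn (_ : 4^-1 * 2 = 2^-1 :> R); last by field.
by rewrite exprD ler_piMr ?exprn_ge0// exprn_ile1//; lra.
Qed.

Lemma raw_weight_sum : (\esum_(o in [set: O]) (raw_weight o)%:E)%E = weight_mass%:E.
Proof.
rewrite fineK// ge0_fin_numE; last first.
  by apply: esum_ge0 => o _; rewrite lee_fin.
apply: (@le_lt_trans _ _ 2%:E%E); last exact: ltry.
apply: le_trans (esum_half_pickle R O); apply: le_esum => o _; rewrite lee_fin.
by apply: le_trans (raw_weight_le o); rewrite ler_peMr// lerDl.
Qed.

Lemma weight_mass_gt0 : 0 < weight_mass.
Proof.
apply: lt_le_trans (raw_weight_gt0 None) _; rewrite -lee_fin -raw_weight_sum.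
by apply: (@esum_ge1 _ _ (fun o => (raw_weight o)%:E)) => o; rewrite lee_fin.
Qed.

Lemma weight_gt0 o : 0 < weight o.
Proof. by rewrite divr_gt0 ?raw_weight_gt0 ?weight_mass_gt0. Qed.

Lemma weight_sum : (\esum_(o in [set: O]) (weight o)%:E = 1)%E.
Proof.
under eq_esum do rewrite /weight mulrC EFinM.
rewrite esumZl; last 2 first.
- by rewrite invr_ge0 ltW// weight_mass_gt0.
- by move=> o; rewrite lee_fin.
by rewrite raw_weight_sum -EFinM mulVf// gt_eqF// weight_mass_gt0.
Qed.

Lemma weight_height : (\esum_(o in [set: O]) (weight o * (height o)%:R)%:E < +oo)%E.
Proof.
have wm0 : 0 <= weight_mass^-1 by rewrite invr_ge0 ltW// weight_mass_gt0.
apply: (@le_lt_trans _ _ (weight_mass^-1%:E * 2%:E)%E); last by rewrite -EFinM ltry.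
apply: le_trans (lee_wpmul2l _ (esum_half_pickle R O)); last first.
  by rewrite lee_fin.
rewrite -esumZl//.
apply: le_esum => o _; rewrite -EFinM lee_fin /weight mulrAC mulrC ler_wpM2l//.
by apply: le_trans (raw_weight_le o); rewrite ler_wpM2l// lerDr.
Qed.

Definition mass (x : X) : R := weight (level x).

Lemma mass_gt0 x : 0 < mass x. Proof. exact: weight_gt0. Qed.

Lemma esum_kernel (v : G -> R) (F : O -> R) (x : X) c :
  (forall g, 0 <= v g) -> (forall o, 0 <= F o) ->
  (\esum_(o in [set: O]) (F o)%:E = c%:E)%E ->
  (\esum_(y in [set: X]) (v ((base x)^-1 * base y)%g * F (level y))%:E =
   c%:E * \esum_(g in [set: G]) (v g)%:E)%E.
Proof.
move=> v0 F0 Fc.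
have c0 : 0 <= c by rewrite -lee_fin -Fc; apply: esum_ge0 => o _; rewrite lee_fin.
rewrite (@esum_cusped (fun y => (v ((base x)^-1 * base y)%g * F (level y))%:E)); last first.
  by move=> y; rewrite lee_fin mulr_ge0.
rewrite -(esum_mulg (base x)^-1%g (fun g => (v g)%:E)) -esumZl//; last first.
  by move=> g; rewrite lee_fin.
apply: eq_esum => g _; rewrite muleC -Fc -esumZl//.
by apply: eq_esum => o _; rewrite base_mk level_mk EFinM.
Qed.

Definition tip k : seq G := ball_seq s (D * 4 ^ k)%N.
Definition unif k g : R := (g \in tip k)%:R / (size (tip k))%:R.
Definition coef k : R := 7%:R / 8%:R * 8%:R^-1 ^+ k.
(** The sum of the coefficients from k on, in closed form. *)
Definition tail k : R := 8%:R^-1 ^+ k.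

Lemma tip_size_gt0 k : 0 < (size (tip k))%:R :> R.
Proof.
have : 1%g \in tip k by exact: one_ball_seq.
by rewrite ltr0n /tip; case: ball_seq.
Qed.

Lemma unif_ge0 k g : 0 <= unif k g.
Proof. by rewrite divr_ge0. Qed.

Lemma coef_ge0 k : 0 <= coef k.
Proof. by rewrite mulr_ge0// exprn_ge0. Qed.
Hint Resolve unif_ge0 coef_ge0 : core.

Lemma esum_unif k (F : G -> R) c : (forall g, 0 <= F g) -> (forall g, g \in tip k -> F g <= c) ->
  (\esum_(g in [set: G]) (unif k g * F g)%:E <= c%:E)%E.
Proof.
move=> F0 Fc; have n0 := tip_size_gt0 k.
rewrite (_ : (\esum_(g in [set: G]) (unif k g * F g)%:E)%E =
    (\esum_(g in [set: G]) ((g \in tip k)%:R * (F g / (size (tip k))%:R))%:E)%E); last first.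
  by apply: eq_esum => g _; rewrite /unif mulrAC mulrA.
rewrite esum_seq ?ball_seq_uniq//; last by move=> g; rewrite divr_ge0.
rewrite lee_fin -mulr_suml ler_pdivrMr//.
apply: (@le_trans _ _ (\sum_(g <- tip k) c)).
  by rewrite big_seq [leRHS]big_seq; apply: ler_sum => g; exact: Fc.
by rewrite big_const_seq count_predT iter_addr_0 mulr_natr.
Qed.

Lemma unif_sum k : (\esum_(g in [set: G]) (unif k g)%:E = 1)%E.
Proof.
rewrite (_ : (\esum_(g in [set: G]) (unif k g)%:E)%E =
    (\esum_(g in [set: G]) ((g \in tip k)%:R * (size (tip k))%:R^-1)%:E)%E)//.
rewrite esum_seq ?ball_seq_uniq// big_const_seq count_predT iter_addr_0.
by rewrite -(mulr_natr _^-1) mulVf// gt_eqF// tip_size_gt0.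
Qed.

Lemma unif_le k g : unif k g <= (size (tip k))%:R^-1.
Proof. by rewrite /unif ler_piMl//; case: (_ \in _). Qed.

Lemma unifV k g : unif k (g^-1)%g = unif k g.
Proof.
rewrite /unif; congr (_%:R / _); congr nat_of_bool.
by apply/idP/idP => /(ball_seqV sV); rewrite ?invgK.
Qed.

Lemma tail_gt0 k : 0 < tail k. Proof. by rewrite exprn_gt0. Qed.

Lemma tailS k : tail k = coef k + tail k.+1.
Proof. by rewrite /tail /coef exprS; field. Qed.

Lemma tail_small e : 0 < e -> exists K, tail K < e.
Proof.
move=> e0; have /cvgrPdist_lt/(_ _ e0)[K _ /(_ K (leqnn K))] : tail K @[K --> \oo] --> (0 : R).
  by apply: cvg_expr; rewrite ger0_norm// invf_lt1// ltr1n.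
by rewrite sub0r normrN => h; exists K; apply: le_lt_trans h; exact: ler_norm.
Qed.

Lemma coef_sum : (\sum_(k <oo) (coef k)%:E = 1)%E.
Proof.
apply/cvg_lim => //; rewrite (_ : (fun n => _) = (fun n => (1 - tail n)%:E)); last first.
  apply/funext => n; rewrite big_mkord sumEFin; congr _%:E.
  elim: n => [|n IH]; first by rewrite big_ord0 /tail expr0 subrr.
  by rewrite big_ord_recr /= IH (tailS n); lra.
rewrite -[X in _ --> X]/((1 : R)%:E); apply: cvg_EFin; first exact: nearW.
rewrite -[X in _ --> X]subr0; apply: cvgB; first exact: cvg_cst.
by apply: cvg_expr; rewrite ger0_norm// invf_lt1// ltr1n.
Qed.

Definition mu (g : G) : R := fine (\sum_(k <oo) (coef k * unif k g)%:E)%E.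

Lemma muE g : (\sum_(k <oo) (coef k * unif k g)%:E = (mu g)%:E)%E.
Proof.
rewrite fineK// ge0_fin_numE; last by apply: nneseries_ge0 => k _ _; rewrite lee_fin mulr_ge0.
apply: (@le_lt_trans _ _ 1%E); last exact: ltry.
rewrite -coef_sum; apply: lee_nneseries => k _; first by rewrite lee_fin mulr_ge0.
rewrite lee_fin ler_piMr//; apply: le_trans (unif_le _ _) _.
by rewrite invf_le1 ?tip_size_gt0// ler1n -(ltr0n R) tip_size_gt0.
Qed.

Lemma mu_ge_sum K g : \sum_(k < K) coef k * unif k g <= mu g.
Proof.
rewrite -lee_fin -muE -sumEFin -(big_mkord xpredT (fun k => (coef k * unif k g)%:E)).
by apply: nneseries_lim_ge => k _ _; rewrite lee_fin mulr_ge0.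
Qed.

Lemma mu_ge k g : coef k * unif k g <= mu g.
Proof.
apply: le_trans (mu_ge_sum k.+1 g); rewrite big_ord_recr /= lerDr.
by apply: sumr_ge0 => i _; rewrite mulr_ge0.
Qed.

Lemma mu_ge0 g : 0 <= mu g.
Proof. by apply: le_trans (mu_ge_sum 0 g); rewrite big_ord0. Qed.
Hint Resolve mu_ge0 : core.

Lemma muV g : mu (g^-1)%g = mu g.
Proof. by rewrite /mu; congr fine; apply: eq_eseriesr => k _; rewrite unifV. Qed.

Lemma mu_gt0 g : 0 < mu g.
Proof.
have [r gr] := ball_seq_gen sV sG g.
apply: lt_le_trans (mu_ge r g); rewrite /coef /unif.
have -> : g \in tip r.
  apply: ball_seq_le gr; apply: leq_trans (leq_pmull _ D0).
  by apply: ltnW; exact: ltn_expl.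
apply: mulr_gt0; last by rewrite divr_gt0// tip_size_gt0.
by rewrite mulr_gt0// exprn_gt0.
Qed.

Lemma esum_mu (F : G -> R) : (forall g, 0 <= F g) ->
  (\esum_(g in [set: G]) (mu g * F g)%:E =
   \sum_(k <oo) ((coef k)%:E * \esum_(g in [set: G]) (unif k g * F g)%:E))%E.
Proof.
move=> F0; rewrite nneseries_esumT; last first.
  by move=> k; rewrite mule_ge0 ?lee_fin//; apply: esum_ge0 => g _; rewrite lee_fin mulr_ge0.
transitivity (\esum_(g in [set: G]) \esum_(k in [set: nat]) (coef k * (unif k g * F g))%:E)%E.
  apply: eq_esum => g _; rewrite -nneseries_esumT; last first.
    by move=> k; rewrite lee_fin !mulr_ge0.
  rewrite mulrC EFinM -muE -nneseriesZl; last by move=> k _; rewrite lee_fin mulr_ge0.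
  by apply: eq_eseriesr => k _; rewrite -EFinM; congr _%:E; ring.
rewrite esum_swap; last by move=> g k; rewrite lee_fin !mulr_ge0.
apply: eq_esum => k _; under eq_esum do rewrite EFinM.
by rewrite esumZl// => g; rewrite lee_fin mulr_ge0.
Qed.

Lemma mu_sum : (\esum_(g in [set: G]) (mu g)%:E = 1)%E.
Proof.
under eq_esum do rewrite -[mu _]mulr1.
rewrite (@esum_mu (fun=> 1))// -coef_sum; apply: eq_eseriesr => k _.
under eq_esum do rewrite mulr1.
by rewrite unif_sum mule1.
Qed.

Definition kernel (x y : X) : R := mu ((base x)^-1 * base y)%g * mass y.

Lemma kernel_gt0 x y : 0 < kernel x y.
Proof. by rewrite mulr_gt0 ?mu_gt0 ?mass_gt0. Qed.

Lemma kernel_ge0 x y : 0 <= kernel x y.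
Proof. exact/ltW/kernel_gt0. Qed.

Lemma kernel_sum x : (\esum_(y in [set: X]) (kernel x y)%:E = 1)%E.
Proof.
rewrite (@esum_kernel mu weight x 1)//; first by rewrite mul1e mu_sum.
  by move=> o; exact/ltW/weight_gt0.
exact: weight_sum.
Qed.

Lemma kernel_reversible : reversible_chain kernel mass (@cusped_act G l).
Proof.
split; [exact: kernel_ge0|exact: kernel_sum| | |].
- move=> x y; exists 1%N; rewrite (nstep1 kernel_ge0) lte_fin; exact: kernel_gt0.
- by move=> g x y; rewrite /kernel /mass !base_act level_act invgM -mulgA mulKg.
split; [exact: mass_gt0|by move=> g x; rewrite /mass level_act|move=> x y].
by rewrite /kernel -[mu (_^-1 * base y)%g]muV invgM invgK; ring.
Qed.

Lemma kernel_green x y :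
  (green kernel x y <= ((x == y)%:R + mass y * (14 * D)%:R)%:E)%E.
Proof.
pose q k (x y : X) : R := unif k ((base x)^-1 * base y)%g * mass y.
apply: (@mixture_green R X mass q coef tail (fun k => (size (tip k))%:R^-1)).
- by move=> z; exact/ltW/mass_gt0.
- by move=> k u v; rewrite mulr_ge0// ltW// mass_gt0.
- move=> k u; rewrite (@esum_kernel (unif k) weight u 1)//.
  + by rewrite mul1e unif_sum.
  + by move=> o; exact/ltW/weight_gt0.
  + exact: weight_sum.
- move=> k u v; rewrite /q -[unif k (_^-1 * base v)%g]unifV invgM invgK; ring.
- by move=> k u v; rewrite /q ler_wpM2r ?unif_le// ltW// mass_gt0.
- by move=> k; rewrite invr_ge0.
- exact: coef_ge0.
- exact: tail_gt0.
- exact: expr0.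
- exact: tailS.
- exact: tail_small.
- move=> K u v; rewrite /trunc_mix /kernel; apply: le_trans (_ : (\sum_(k < K)
      coef k * unif k ((base u)^-1 * base v)%g) * mass v <= _).
    by rewrite mulr_suml; apply: ler_sum => k _; rewrite /q mulrA.
  by rewrite ler_wpM2r ?mu_ge_sum// ltW// mass_gt0.
- exact: kernel_sum.
(* The k-th gap equals 7 times 8^k over the size of the k-th ball. Growth at 4^k gives 16^k <= D
   times that size, so the gap is at most 7 D 2^-k, and the gaps sum to at most 14 D. *)
move=> K; apply: le_trans (_ : \sum_(k < K) (7 * D)%:R * (2^-1 : R) ^+ k <= _).
  apply: ler_sum => k _; rewrite /mix_gap /coef /tail.
  have := growth (4 ^ k)%N; rewrite -/(tip k) -expnMn => gr.
  have gr' : 16 ^+ k <= D%:R * (size (tip k))%:R :> R.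
    by rewrite -natrX -natrM ler_nat.
  have n0 := tip_size_gt0 k.
  set n : R := (size (tip k))%:R in gr' n0 *.
  pose z : R := 2 ^+ k; have z0 : 0 < z by rewrite exprn_gt0.
  have e8 : 8%:R^-1 ^+ k = (z ^+ 3)^-1 :> R.
    by rewrite exprVn /z -exprM mulnC exprM; congr (_ ^+ _)^-1; ring.
  have e16 : 16 ^+ k = z ^+ 4 :> R.
    by rewrite /z -exprM mulnC exprM; congr (_ ^+ _); ring.
  rewrite exprS e8 exprVn -/z natrM.
  rewrite [leLHS](_ : _ = 7 * z ^+ 3 / n); last by field; rewrite !gt_eqF.
  rewrite ler_pdivrMr// mulrAC ler_pdivlMr//.
  by move: gr'; rewrite e16 exprSr; lra.
rewrite -mulr_sumr half_sum.
have : 0 <= 2^-1 ^+ K :> R by rewrite exprn_ge0.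
rewrite (_ : (14 * D)%:R = (7 * D)%:R * 2 :> R); last by rewrite -natrM; congr _%:R; lia.
by move=> h; rewrite ler_wpM2l//; lra.
Qed.

Lemma kernel_transient : transient kernel.
Proof. by move=> x y; apply: le_lt_trans (kernel_green x y) (ltry _). Qed.

(** * Reduction of the chain to functions on the group *)

Definition walk_prob n (g : G) : R := fine (nstep kernel n (inl 1%g) (inl g)).

Definition origin_mass : R := weight None.

Lemma nstep_act n g x y : nstep kernel n (cusped_act g x) (cusped_act g y) = nstep kernel n x y.
Proof.
elim: n x => [|n IH] x /=.
  congr ((_)%:R)%:E; congr nat_of_bool; apply/eqP/eqP => [|->//].
  by move=> /(congr1 (cusped_act (g^-1)%g)); rewrite !actM mulVg !act1.
rewrite (reindex_esum [set: X] _ (cusped_act g)).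
  apply: eq_esum => z _; rewrite IH; congr (_%:E * _)%E.
  by case: kernel_reversible.
split=> // [u v _ _ /(congr1 (cusped_act (g^-1)%g))|z _].
  by rewrite !actM mulVg !act1.
by exists (cusped_act (g^-1)%g z) => //; rewrite actM mulgV act1.
Qed.

(** The kernel ignores the level of its first argument, and the level of its second enters only
    through [mass]. So only the last step sees the level of y, and replacing that level rescales the
    probability. There must be a last step, hence n.+1. *)
Lemma nstep_base n x y :
  (nstep kernel n.+1 x y * (origin_mass)%:E =
   (mass y)%:E * nstep kernel n.+1 (inl (base x)) (inl (base y)))%E.
Proof.
have base1 n' x' y' : nstep kernel n'.+1 x' y' = nstep kernel n'.+1 (inl (base x')) y'.
  by apply: eq_esum.
rewrite base1; elim: n (inl (base x)) => [|n IH] {}x.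
  rewrite !(nstep1 kernel_ge0) -!EFinM; congr _%:E; rewrite /kernel /=.
  by rewrite /mass /origin_mass /=; ring.
have h z : (0 <= (kernel x z)%:E * nstep kernel n.+1 z y)%E.
  by rewrite mule_ge0 ?lee_fin ?kernel_ge0//; exact: (nstep_ge0 kernel_ge0).
have h' z : (0 <= (kernel x z)%:E * nstep kernel n.+1 z (inl (base y)))%E.
  by rewrite mule_ge0 ?lee_fin ?kernel_ge0//; exact: (nstep_ge0 kernel_ge0).
have om : 0 <= origin_mass by exact/ltW/weight_gt0.
have my : 0 <= mass y by exact/ltW/mass_gt0.
transitivity (\esum_(z in [set: X]) (origin_mass%:E * ((kernel x z)%:E * nstep kernel n.+1 z y)))%E.
  by rewrite esumZl// muleC.
transitivity (\esum_(z in [set: X]) ((mass y)%:E * ((kernel x z)%:E * nstep kernel n.+1 z (inl (base y)))))%E; last first.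
  by rewrite esumZl.
apply: eq_esum => z _; rewrite muleCA [RHS]muleCA; congr (_ * _)%E.
by rewrite muleC IH.
Qed.

Let nge0 n x y : (0 <= nstep kernel n x y)%E := nstep_ge0 kernel_ge0 n x y.

Let ksum1 x : (\esum_(y in [set: X]) (kernel x y)%:E <= 1)%E.
Proof. by rewrite kernel_sum. Qed.

Lemma origin_mass_gt0 : 0 < origin_mass. Proof. exact: weight_gt0. Qed.

Lemma walk_probE n g : nstep kernel n (inl 1%g) (inl g) = (walk_prob n g)%:E.
Proof. by rewrite fineK// (nstep_fin kernel_ge0 ksum1). Qed.

Lemma nstep_walk n g h : nstep kernel n (inl g) (inl h) = (walk_prob n (g^-1 * h)%g)%:E.
Proof. by rewrite -walk_probE -(nstep_act n g (inl 1%g)) /= mulg1 mulVKg. Qed.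

Lemma walk_prob_le1 n g : walk_prob n g <= 1.
Proof. by rewrite -lee_fin -walk_probE; exact: (nstep_le1 kernel_ge0 ksum1). Qed.

Lemma walk_prob1 g : walk_prob 1 g = mu g * origin_mass.
Proof. by rewrite /walk_prob (nstep1 kernel_ge0) /kernel /= invg1 mul1g. Qed.

Lemma walk_probM n k g h : walk_prob n g * walk_prob k h <= walk_prob (n + k) (g * h)%g.
Proof.
rewrite -lee_fin EFinM -!walk_probE.
have -> : nstep kernel k (inl 1%g) (inl h) = nstep kernel k (inl g) (inl (g * h)%g).
  by rewrite -(nstep_act k g (inl 1%g)) /= mulg1.
exact: (nstepD kernel_ge0 ksum1).
Qed.

Lemma walk_prob_gt0 n g : 0 < walk_prob n.+1 g.
Proof.
have h1 k : 0 < walk_prob 1 k by rewrite walk_prob1 mulr_gt0// ?mu_gt0// origin_mass_gt0.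
elim: n g => // n IH g; rewrite -[g]mul1g -add1n.
by apply: lt_le_trans (walk_probM _ _ _ _); rewrite mulr_gt0.
Qed.

Lemma nstep_chain n x y : fine (nstep kernel n.+1 x y) =
  walk_prob n.+1 ((base x)^-1 * base y)%g * (mass y / origin_mass).
Proof.
have om := origin_mass_gt0.
have := nstep_base n x y; rewrite nstep_walk => /(congr1 fine).
have -> : nstep kernel n.+1 x y = (fine (nstep kernel n.+1 x y))%:E.
  by rewrite fineK// (nstep_fin kernel_ge0 ksum1).
rewrite -!EFinM /= => e; rewrite mulrA [_ * mass y]mulrC -e mulfK// gt_eqF//.
Qed.

Definition walk_green (g : G) : R := fine (green_plus kernel (inl 1%g) (inl g)).

Lemma green_plus_fin x y : green_plus kernel x y \is a fin_num.
Proof.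
rewrite ge0_fin_numE ?(green_plus_ge0 kernel_ge0)//.
apply: le_lt_trans (kernel_transient x y); rewrite (greenE kernel_ge0) leeDr//.
Qed.

Lemma walk_greenE g : green_plus kernel (inl 1%g) (inl g) = (walk_green g)%:E.
Proof. by rewrite fineK// green_plus_fin. Qed.

Lemma green_plus_chain x y : fine (green_plus kernel x y) =
  walk_green ((base x)^-1 * base y)%g * (mass y / origin_mass).
Proof.
have om := origin_mass_gt0.
suff e : (green_plus kernel x y * origin_mass%:E =
    (mass y)%:E * (walk_green ((base x)^-1 * base y)%g)%:E)%E.
  move: e; rewrite -(fineK (green_plus_fin x y)) -!EFinM => -[e].
  by rewrite /= mulrA [_ * mass y]mulrC -e mulfK// gt_eqF.
rewrite -walk_greenE /green_plus muleC -!nneseriesZl//.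
rewrite -[LHS](@nneseries_addn _ _ 1); last first.
  by move=> n; rewrite mule_ge0// lee_fin ltW.
rewrite -[RHS](@nneseries_addn _ _ 1); last first.
  by move=> n; rewrite mule_ge0// lee_fin ltW// mass_gt0.
by apply: eq_eseriesr => n _; rewrite addn1 muleC nstep_base !nstep_walk invg1 mul1g.
Qed.

Lemma walk_green_ge g : walk_prob 1 g <= walk_green g.
Proof. by rewrite -lee_fin -walk_greenE -walk_probE; exact: (green_plus_ge kernel_ge0). Qed.

Lemma walk_green_gt0 g : 0 < walk_green g.
Proof. exact: lt_le_trans (walk_prob_gt0 0 g) (walk_green_ge g). Qed.

Definition green_bound : R := 1 + origin_mass * (14 * D)%:R.

Lemma walk_green_le g : walk_green g <= green_bound.
Proof.
rewrite -lee_fin -walk_greenE.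
apply: le_trans (_ : green kernel (inl 1%g) (inl g) <= _)%E.
  by rewrite (greenE kernel_ge0) leeDr// lee_fin ler0n.
apply: le_trans (kernel_green _ _) _; by rewrite lee_fin lerD2r lern1 leq_b1.
Qed.

(** G(o,o) comes from the first visit. The division by p(o,o) bounds G by [walk_green]: one
    preliminary step from o to o turns the time-zero term into a term of positive time. *)
Definition green_defect : R := green_fin kernel (inl 1%g) (inl 1%g) / kernel (inl 1%g) (inl 1%g).

Lemma green_act g x y : green kernel (cusped_act g x) (cusped_act g y) = green kernel x y.
Proof. by apply: eq_eseriesr => n _; rewrite nstep_act. Qed.

Lemma green_finE x y : green kernel x y = (green_fin kernel x y)%:E.
Proof. by rewrite fineK// ge0_fin_numE ?kernel_transient// (green_ge0 kernel_ge0). Qed.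

Lemma walk_greenM g h : walk_green g * walk_green h <= green_defect * walk_green (g * h)%g.
Proof.
have le k : walk_green k <= green_fin kernel (inl 1%g) (inl k).
  rewrite -lee_fin -walk_greenE -green_finE (greenE kernel_ge0) leeDr// lee_fin ler0n.
have := green_mul kernel_ge0 (inl 1%g) (inl g) (inl (g * h)%g) kernel_transient.
have -> : green_fin kernel (inl g) (inl (g * h)%g) = green_fin kernel (inl 1%g) (inl h).
  by rewrite /green_fin -(green_act g (inl 1%g)) /= mulg1.
have -> : green_fin kernel (inl g) (inl g) = green_fin kernel (inl 1%g) (inl 1%g).
  by rewrite /green_fin -(green_act g (inl 1%g)) /= mulg1.
move=> gm.
have step : kernel (inl 1%g) (inl 1%g) * green_fin kernel (inl 1%g) (inl (g * h)%g) <=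
    walk_green (g * h)%g.
  by rewrite -lee_fin -walk_greenE EFinM -green_finE; exact: (green_plus_step kernel_ge0).
apply: (@le_trans _ _ (green_fin kernel (inl 1%g) (inl g) * green_fin kernel (inl 1%g) (inl h))).
  by apply: ler_pM; rewrite ?le// ltW// walk_green_gt0.
apply: le_trans gm _; have k0 : 0 < kernel (inl 1%g) (inl 1%g) := kernel_gt0 _ _.
rewrite /green_defect -mulrA ler_wpM2l ?fine_ge0 ?(green_ge0 kernel_ge0)//.
by rewrite ler_pdivlMl.
Qed.

Lemma green_defect_ge0 : 0 <= green_defect.
Proof. by rewrite divr_ge0 ?kernel_ge0// fine_ge0// (green_ge0 kernel_ge0). Qed.

Lemma green_fin_chain x y : x != y ->
  green_fin kernel x y = walk_green ((base x)^-1 * base y)%g * (mass y / origin_mass).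
Proof.
by move=> xy; rewrite -green_plus_chain /green_fin (greenE kernel_ge0) (negbTE xy) add0e.
Qed.

Lemma kernel_has_green_metric : has_green_metric kernel mass.
Proof.
split; first exact: kernel_transient.
have om := origin_mass_gt0; have gd := green_defect_ge0.
have gb : 0 < green_bound by rewrite /green_bound ltr_pwDl// mulr_ge0// ltW.
have e1 : 0 < expR 1 :> R := expR_gt0 1.
(* The first summand gives 1 <= c, the second compensates the defect in [walk_greenM], and the third
   brings the normalized Green function below exp(-1). *)
pose c := 2 + green_defect / origin_mass + expR 1 * green_bound / origin_mass.
have d0 : 0 <= green_defect / origin_mass by rewrite divr_ge0// ltW.
have f0 : 0 <= expR 1 * green_bound / origin_mass.
  by apply: divr_ge0; [apply: mulr_ge0; exact: ltW|exact: ltW].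
have c0 : 0 < c by rewrite /c; lra.
have cdef : green_defect <= c * origin_mass.
  by rewrite -ler_pdivrMr// /c; lra.
have cbd : expR 1 * green_bound < c * origin_mass.
  by rewrite -ltr_pdivrMr// /c; lra.
exists c; split; first by rewrite /c; lra.
move=> x y z yx yz; have my := mass_gt0 y; have mz := mass_gt0 z.
set g := ((base x)^-1 * base y)%g; set h := ((base y)^-1 * base z)%g.
have gh : ((base x)^-1 * base z = g * h)%g by rewrite mulgA mulgK.
rewrite (green_fin_chain (_ : x != y)) 1?eq_sym// (green_fin_chain yz) -/g -/h.
have -> : walk_green g * (mass y / origin_mass) / (c * mass y) =
    walk_green g / (c * origin_mass) by field; rewrite !gt_eqF.
have -> : walk_green h * (mass z / origin_mass) / (c * mass z) =
    walk_green h / (c * origin_mass) by field; rewrite !gt_eqF.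
have co : 0 < c * origin_mass by rewrite mulr_gt0.
split; last first.
  rewrite ltr_pdivrMr// expRN ltr_pdivlMl//; apply: le_lt_trans cbd.
  by rewrite ler_pM2l// walk_green_le.
(* The vertices x and z may coincide, and then G(x,z) also contains the time-zero term; so
   [walk_green] is only a lower bound here. *)
apply: (@le_trans _ _ (walk_green (g * h)%g / (c * origin_mass))); last first.
  rewrite ler_pdivlMr; last exact: mulr_gt0.
  have -> : walk_green (g * h)%g / (c * origin_mass) * (c * mass z) =
     walk_green ((base x)^-1 * base z)%g * (mass z / origin_mass).
    by rewrite gh; field; rewrite !gt_eqF.
  rewrite -green_plus_chain -lee_fin (fineK (green_plus_fin x z)) -green_finE.
  by rewrite (greenE kernel_ge0) leeDr// lee_fin ler0n.
rewrite mulf_div ler_pdivrMr; last exact: mulr_gt0.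
rewrite mulrA divfK ?gt_eqF//.
apply: le_trans (walk_greenM g h) _; rewrite [leRHS]mulrC; apply: ler_wpM2r => //.
exact/ltW/walk_green_gt0.
Qed.

(** Nothing in [groupType] makes G countable; it is the union of its finite balls. *)
Lemma group_code : exists code : G -> nat, injective code.
Proof.
suff /countable_injP[c cinj] : countable [set: G].
  by exists c => x y; apply: cinj; rewrite inE.
have -> : [set: G] = \bigcup_(r in [set: nat]) [set` ball_seq s r].
  by apply/seteqP; split=> // g _; have [r gr] := ball_seq_gen sV sG g; exists r.
apply: bigcup_countable; first exact: countableP.
by move=> r _; apply: finite_set_countable; exact: finite_seq.
Qed.

Lemma cusped_code : exists code : X -> nat, injective code.
Proof.
have [c cinj] := group_code; exists (fun x => pickle (c (base x), level x)) => x y.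
by move=> /(pcan_inj pickleK)[/cinj bxy lxy]; exact: base_level_inj.
Qed.

Lemma coef4_sum n : \sum_(k < n) coef k * 4 ^+ k <= 2.
Proof.
apply: (@le_trans _ _ (\sum_(k < n) 2^-1 ^+ k)); last first.
  by rewrite half_sum gerBl mulr_ge0// exprn_ge0.
apply: ler_sum => k _.
rewrite (_ : coef k * 4 ^+ k = 7 / 8 * (8%:R^-1 * 4) ^+ k); last by rewrite exprMn /coef; ring.
rewrite (_ : 8%:R^-1 * 4 = 2^-1 :> R); last by field.
by rewrite ler_piMl ?exprn_ge0//; lra.
Qed.

Lemma increment_integrable (phi : G -> R) L : (forall g, 0 <= phi g) ->
  (forall k g, g \in tip k -> phi g <= L * 4 ^+ k) ->
  (\esum_(t in [set: X]) (kernel (inl 1%g) t * phi (base t))%:E < +oo)%E.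
Proof.
move=> phi0 phiL.
have L0 : 0 <= L.
  have := phiL 0%N 1%g (one_ball_seq _ _); rewrite expr0 mulr1; exact: le_trans.
pose v g := mu g * phi g.
have -> : (\esum_(t in [set: X]) (kernel (inl 1%g) t * phi (base t))%:E =
    \esum_(t in [set: X]) (v ((base (inl 1%g : X))^-1 * base t)%g * weight (level t))%:E)%E.
  apply: eq_esum => t _; rewrite /kernel /v /= invg1 mul1g /mass; congr _%:E; ring.
rewrite (@esum_kernel v weight _ 1); last 3 first.
- by move=> g; rewrite mulr_ge0.
- by move=> o; exact/ltW/weight_gt0.
- exact: weight_sum.
rewrite mul1e esum_mu//; apply: (@le_lt_trans _ _ (2 * L)%:E); last exact: ltry.
have t0 k : (0 <= (coef k)%:E * \esum_(g in [set: G]) (unif k g * phi g)%:E)%E.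
  by rewrite mule_ge0 ?lee_fin//; apply: esum_ge0 => g _; rewrite lee_fin mulr_ge0.
apply: lime_le; first exact: is_cvg_nneseries.
apply: nearW => n; rewrite big_mkord.
apply: (@le_trans _ _ (\sum_(k < n) (coef k * (L * 4 ^+ k))%:E)%E).
  apply: lee_sum => k _; rewrite [leRHS]EFinM; apply: lee_wpmul2l; first by rewrite lee_fin.
  by apply: esum_unif => // g; exact: phiL.
rewrite sumEFin lee_fin; under eq_bigr do rewrite mulrCA mulrC.
by rewrite -mulr_suml ler_wpM2r// coef4_sum.
Qed.

Lemma height_integrable :
  (\esum_(t in [set: X]) (kernel (inl 1%g) t * (height (level t))%:R)%:E < +oo)%E.
Proof.
have -> : (\esum_(t in [set: X]) (kernel (inl 1%g) t * (height (level t))%:R)%:E =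
    \esum_(t in [set: X]) (mu ((base (inl 1%g : X))^-1 * base t)%g *
      (weight (level t) * (height (level t))%:R))%:E)%E.
  by apply: eq_esum => t _; rewrite /kernel /mass mulrA.
have wh o : 0 <= weight o * (height o)%:R by rewrite mulr_ge0// ltW// weight_gt0.
have whf : (\esum_(o in [set: O]) (weight o * (height o)%:R)%:E)%E \is a fin_num.
  by rewrite ge0_fin_numE ?weight_height//; apply: esum_ge0 => o _; rewrite lee_fin.
rewrite (@esum_kernel mu _ _ _ mu_ge0 wh (esym (fineK whf))).
by rewrite mu_sum mule1 ltry.
Qed.

(** A ball has at most exponentially many elements in its radius, and the logarithm of the
    coefficient is linear in k, hence at most of order 4^k. So -log of the one-step probability is
    controlled by the radius, and its mean by the first moment. *)
Lemma walk_entropy_bound : exists L, forall k g, g \in tip k ->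
  - ln (walk_prob 1 g) <= L * 4 ^+ k.
Proof.
pose u1 : R := ln (7 / 8); pose u8 : R := ln 8.
pose L : R := `|u1| + u8 + D%:R * ln (size s).+1%:R + `|ln origin_mass|.
exists L => k g gk.
have n0 := tip_size_gt0 k; have om := origin_mass_gt0.
have c0 : 0 < coef k by rewrite mulr_gt0// exprn_gt0.
have ge : coef k / (size (tip k))%:R * origin_mass <= walk_prob 1 g.
  rewrite walk_prob1; apply: ler_wpM2r; first exact: ltW.
  apply: le_trans (mu_ge k g).
  by rewrite /unif gk mul1r.
have pos : 0 < coef k / (size (tip k))%:R * origin_mass by rewrite mulr_gt0// divr_gt0.
have h1 : ln (coef k / (size (tip k))%:R * origin_mass) <= ln (walk_prob 1 g).
  by rewrite ler_ln ?posrE// (lt_le_trans pos).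
have h2 : ln (coef k / (size (tip k))%:R * origin_mass) =
    u1 - k%:R * u8 - ln (size (tip k))%:R + ln origin_mass.
  have lm (u v : R) : 0 < u -> 0 < v -> ln (u * v) = ln u + ln v.
    by move=> u0 v0; rewrite lnM// posrE.
  have nV : 0 < (size (tip k))%:R^-1 :> R by rewrite invr_gt0.
  have e0 : 0 < 8%:R^-1 ^+ k :> R by rewrite exprn_gt0.
  rewrite (lm _ _ _ om); last exact: mulr_gt0.
  rewrite (lm _ _ c0 nV) (lm _ _ _ e0)//.
  rewrite lnV ?posrE// exprVn lnV ?posrE ?exprn_gt0//.
  by rewrite lnXn// -(mulr_natl (ln 8) k).
have h3 : ln (size (tip k))%:R <= D%:R * 4 ^+ k * ln (size s).+1%:R :> R.
  apply: (@le_trans _ _ (ln ((size s).+1%:R ^+ (D * 4 ^ k)))).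
    by rewrite ler_ln ?posrE ?exprn_gt0// -natrX ler_nat size_ball_seq.
  by rewrite lnXn// -(mulr_natl (ln _)) natrM natrX.
have k4 : k%:R <= 4 ^+ k :> R by rewrite -natrX ler_nat ltnW// ltn_expl.
have o4 : 1 <= 4 ^+ k :> R by rewrite exprn_ege1// ler1n.
have l8 : 0 <= u8 by rewrite ln_ge0// ler1n.
have a1 := ler_norm (- u1); have a2 := ler_norm (- ln origin_mass).
rewrite normrN in a1; rewrite normrN in a2.
have b1 : 0 <= `|u1| by []. have b2 : 0 <= `|ln origin_mass| by [].
have b3 : k%:R * u8 <= 4 ^+ k * u8 by rewrite ler_wpM2r.
have b4 : `|u1| <= `|u1| * 4 ^+ k by rewrite ler_peMr.
have b5 : `|ln origin_mass| <= `|ln origin_mass| * 4 ^+ k by rewrite ler_peMr.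
rewrite h2 in h1; rewrite /L !mulrDl (mulrAC D%:R) (mulrC u8); lra.
Qed.

(** * Linear rates along sequences of increments *)

Fixpoint position n (t : nat -> X) : G :=
  if n is n'.+1 then (position n' t * base (t n'))%g else 1%g.

Lemma positionD n m t :
  position (n + m) t = (position n t * position m (fun k => t (n + k)%N))%g.
Proof.
by elim: m => [|m IH]; rewrite ?addn0 ?mulg1// addnS /= IH mulgA.
Qed.

Lemma position_prefix n t t' : (forall k, (k < n)%N -> t k = t' k) -> position n t = position n t'.
Proof.
by elim: n => //= n IH h; rewrite IH ?h// => k kn; rewrite h// ltnW.
Qed.

Definition step_law (t : increment G l) : R := kernel (inl 1%g) t.

Lemma walk_subadditive (phi : nat -> G -> R) L : (forall n g, 0 <= phi n g) ->
  (forall n m g h, phi (n.+1 + m.+1)%N (g * h)%g <= phi n.+1 g + phi m.+1 h) ->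
  (forall k g, g \in tip k -> phi 1%N g <= L * 4 ^+ k) ->
  exists (c : R) (B : set (seqsp (increment G l))),
    [/\ measurable B,
        (forall Q : probability (seqsp (increment G l)) R, bernoulli_law step_law Q -> Q B = 0%E) &
      forall t, ~ B t -> phi n (position n t) / n%:R @[n --> \oo] --> c].
Proof.
move=> phi0 sub phiL; have [code code_inj] := cusped_code.
(* Subadditivity of [phi] is assumed at positive times only; the value 0 at time zero extends it to
   all times and leaves the limit unchanged. *)
pose f n (t : nat -> increment G l) := if n is 0 then 0 else phi n (position n t).
have [] := @bernoulli_subadditive R (increment G l) code step_law code_inj
  (kernel_ge0 (inl 1%g)) (kernel_sum (inl 1%g)) f (fun t => phi 1%N (base t)).
- by case=> // n t t' tt' /=; congr (phi _ (_ * _)%g); [apply: position_prefix => k kn; rewrite tt'// ltnW|rewrite tt'].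
- by case=> [|n] t /=.
- case=> [|n] m t; first by rewrite add0r.
  case: m => [|m]; first by rewrite addn0 addr0.
  rewrite /f -/(position n.+1 t) {1}addSn.
  have := sub n m (position n.+1 t) (position m.+1 (fun k => t (n.+1 + k)%N)).
  by rewrite -positionD.
- by move=> t; rewrite /f /= mul1g.
- exact: (@increment_integrable (phi 1%N) L).
move=> c [B [mB QB cB]]; exists c, B; split=> // t nBt.
by apply: cvg_trans (cB t nBt); apply: near_eq_cvg; exists 1%N => // -[|n].
Qed.

(** The sums of the heights have a finite linear rate, so their successive differences are o(n). The
    division is by n + 1 because [t n] carries the level of the vertex at time n + 1. *)
Lemma height_limit : exists (B : set (seqsp (increment G l))),
    [/\ measurable B,
        (forall Q : probability (seqsp (increment G l)) R, bernoulli_law step_law Q -> Q B = 0%E) &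
      forall t, ~ B t -> (height (level (t n)))%:R / n.+1%:R @[n --> \oo] --> (0 : R)].
Proof.
have [code code_inj] := cusped_code.
pose hgt (x : X) : R := (height (level x))%:R.
pose f n (t : nat -> increment G l) : R := \sum_(k < n) hgt (t k).
have [] := @bernoulli_subadditive R (increment G l) code step_law code_inj
  (kernel_ge0 (inl 1%g)) (kernel_sum (inl 1%g)) f hgt.
- by move=> n t t' tt'; apply: eq_bigr => k _; rewrite tt'.
- by move=> n t; apply: sumr_ge0.
- by move=> n m t; rewrite /f big_split_ord.
- by move=> t; rewrite /f big_ord1.
- exact: height_integrable.
move=> c [B [mB QB cB]]; exists B; split=> // t /cB ct.
have ct1 : f n.+1 t / n.+1%:R @[n --> \oo] --> c.
  by have := ct; rewrite -(cvg_shiftS (fun n => f n t / n%:R)).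
have n1 : (n%:R : R) / n.+1%:R @[n --> \oo] --> (1 : R).
  rewrite (_ : (fun n => _) = (fun n => 1 - n.+1%:R^-1)); last first.
    apply/funext => n; transitivity ((n.+1%:R - 1) / n.+1%:R : R).
      by rewrite -natr1 addrK.
    by rewrite mulrBl divff ?mul1r// pnatr_eq0.
  rewrite -[X in _ --> X]subr0; apply: cvgB; first exact: cvg_cst.
  exact: cvg_harmonic.
have ct0 : f n t / n.+1%:R @[n --> \oo] --> c.
  rewrite (_ : (fun n => _) = (fun n => f n t / n%:R * (n%:R / n.+1%:R))); last first.
    apply/funext => -[|n]; first by rewrite /f big_ord0 !mul0r.
    by rewrite mulrA divfK// pnatr_eq0.
  by rewrite -[X in _ --> X]mulr1; apply: cvgM.
rewrite (_ : (fun n => _) = (fun n => f n.+1 t / n.+1%:R - f n t / n.+1%:R)); last first.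
  by apply/funext => n; rewrite -mulrBl /f big_ord_recr /= addrAC subrr add0r.
by rewrite -[X in _ --> X](subrr c); apply: cvgB.
Qed.

Lemma cvg_squeeze_height (u v : nat -> R) (e : nat -> nat) (c C C' : R) :
  u n / n%:R @[n --> \oo] --> c -> (e n)%:R / n.+1%:R @[n --> \oo] --> (0 : R) ->
  (forall n, `|v n.+1 - u n.+1| <= C + C' * (e n)%:R) ->
  v n / n%:R @[n --> \oo] --> c.
Proof.
move=> uc ec vu.
rewrite -(cvg_shiftS (fun n => v n / n%:R)).
have uc1 : u n.+1 / n.+1%:R @[n --> \oo] --> c.
  by have := uc; rewrite -(cvg_shiftS (fun n => u n / n%:R)).
have inv0 : n.+1%:R^-1 @[n --> \oo] --> (0 : R) by exact: cvg_harmonic.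
have z0 : C * n.+1%:R^-1 + C' * ((e n)%:R / n.+1%:R) @[n --> \oo] --> (0 : R).
  rewrite -[X in _ --> X](_ : C * 0 + C' * 0 = 0 :> R); last by rewrite !mulr0 addr0.
  by apply: cvgD; apply: cvgMr.
have d0 : (v n.+1 - u n.+1) / n.+1%:R @[n --> \oo] --> (0 : R).
  have zN : - (C * n.+1%:R^-1 + C' * ((e n)%:R / n.+1%:R)) @[n --> \oo] --> (0 : R).
    by rewrite -[X in _ --> X]oppr0; apply: cvgN.
  apply: (squeeze_cvgr _ zN z0); apply: nearW => n.
  have := vu n; rewrite ler_norml => /andP[vu1 vu2].
  have -> : C * n.+1%:R^-1 + C' * ((e n)%:R / n.+1%:R) = (C + C' * (e n)%:R) / n.+1%:R by ring.
  by rewrite -mulNr !ler_wpM2r.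
rewrite (_ : (fun n => _) = (fun n => (v n.+1 - u n.+1) / n.+1%:R + u n.+1 / n.+1%:R)).
  have -> : c = 0 + c by rewrite add0r.
  exact: (cvgD d0 uc1).
by apply/funext => n; rewrite -mulrDl subrK.
Qed.

Section Limits.
Variables (H : 'I_l -> set G) (a : R).
Hypothesis H_subgroup : forall i, is_subgroup (H i).
Hypothesis a1 : 1 < a.

Notation rho := (@rho_X R G l H [set` s] a).
Notation limit_ae phi c := (exists (B : set (seqsp (increment G l))),
    [/\ measurable B,
        (forall Q : probability (seqsp (increment G l)) R, bernoulli_law step_law Q -> Q B = 0%E) &
      forall t, ~ B t -> phi n (position n t) / n%:R @[n --> \oo] --> (c : R)]).

Lemma drift_limit : exists c : R, limit_ae (fun (_ : nat) g => rho (inl 1%g) (inl g)) c.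
Proof.
apply: (@walk_subadditive (fun (_ : nat) g => rho (inl 1%g) (inl g)) D%:R) => //.
  move=> _ _ g h.
  apply: le_trans (rho_triangle H_subgroup a1 sV sG (inl 1%g) (inl g) (inl (g * h)%g)) _.
  rewrite lerD2l; have := rho_act H_subgroup a1 sV sG g (inl 1%g) (inl h).
  by rewrite /= mulg1 => ->.
by move=> k g gk; rewrite -natrX -natrM; exact: rho_ball.
Qed.

(** Large enough for the quotient [walk_green g / green_scale] to be at most 1 and
    supermultiplicative, so that minus its logarithm is nonnegative and subadditive. *)
Definition green_scale : R := green_defect + green_bound.

Lemma green_scale_gt0 : 0 < green_scale.
Proof.
rewrite ltr_wpDl ?green_defect_ge0// /green_bound ltr_pwDl// mulr_ge0// ltW//.
exact: origin_mass_gt0.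
Qed.

Lemma green_limit : exists c : R, limit_ae (fun (_ : nat) g => - ln (walk_green g / green_scale)) c.
Proof.
have gs := green_scale_gt0; have [L entL] := walk_entropy_bound.
have wg g : 0 < walk_green g / green_scale by rewrite divr_gt0 ?walk_green_gt0.
apply: (@walk_subadditive (fun (_ : nat) g => - ln (walk_green g / green_scale))
  (L + `|ln green_scale|)).
- move=> _ g; rewrite oppr_ge0 ln_le0// ler_pdivrMr// mul1r.
  by apply: le_trans (walk_green_le g) _; rewrite lerDr green_defect_ge0.
- move=> _ _ g h; rewrite -opprD lerN2 -lnM ?posrE//.
  rewrite ler_ln ?posrE; [|exact: mulr_gt0|exact: wg].
  rewrite mulf_div ler_pdivrMr ?mulr_gt0// mulrA divfK ?gt_eqF//.
  apply: le_trans (walk_greenM g h) _; rewrite [leRHS]mulrC; apply: ler_wpM2r => //.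
    exact/ltW/walk_green_gt0.
  by rewrite lerDl ltW// /green_bound ltr_pwDl// mulr_ge0// ltW// origin_mass_gt0.
move=> k g gk; rewrite ln_div ?posrE ?walk_green_gt0// mulrDl opprB addrC.
(* [walk_green] dominates the one-step probability, so the entropy bound applies to it as well; the
   normalization adds a constant. *)
apply: lerD.
  apply: le_trans (entL k g gk); rewrite lerN2 ler_ln ?posrE ?walk_green_gt0 ?walk_prob_gt0//.
  exact: walk_green_ge.
apply: le_trans (ler_norm _) _; rewrite ler_peMr// exprn_ege1// ler1n//.
Qed.

Lemma entropy_limit : exists c : R, limit_ae (fun n g => - ln (walk_prob n g)) c.
Proof.
have [L entL] := walk_entropy_bound.
apply: (@walk_subadditive (fun n g => - ln (walk_prob n g)) L) => //.
  by move=> n g; rewrite oppr_ge0 ln_le0// walk_prob_le1.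
move=> n m g h; rewrite -opprD lerN2 -lnM ?posrE ?walk_prob_gt0//.
by rewrite ler_ln ?posrE ?mulr_gt0 ?walk_prob_gt0// addnS ?walk_prob_gt0// -addnS walk_probM.
Qed.

End Limits.

(** * From a process to its increments *)

Section Trajectories.
Context (d : measure_display) (Omega : measurableType d)
  (P : X -> probability Omega R) (Y : nat -> Omega -> X).
Hypothesis PY : markov_process kernel P Y.

(** Only the base of the current vertex is undone. Since the kernel ignores the current level, this
    is enough for the increments to be independent with law [step_law]. *)
Definition increments (w : Omega) : seqsp (increment G l) :=
  fun k => cusped_act (base (Y k w))^-1%g (Y k.+1 w).

Lemma base_increments w k : base (increments w k) = ((base (Y k w))^-1 * base (Y k.+1 w))%g.
Proof. by rewrite /increments base_act. Qed.

Lemma level_increments w k : level (increments w k) = level (Y k.+1 w).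
Proof. by rewrite /increments level_act. Qed.

Lemma position_increments w n :
  position n (increments w) = ((base (Y 0%N w))^-1 * base (Y n w))%g.
Proof.
elim: n => [|n IH]; first by rewrite /= mulVg.
by rewrite /= IH base_increments mulgA mulgK.
Qed.

Definition trajectory (x : X) (t : nat -> X) : nat -> X :=
  fix y n := if n is n'.+1 then cusped_act (base (y n')) (t n') else x.

Lemma increments_cyl x n t w :
  (Y 0%N w = x /\ forall k, (k < n)%N -> increments w k = t k) <->
  (forall k, (k <= n)%N -> Y k w = trajectory x t k).
Proof.
split=> [[Y0 inc]|h].
  elim=> [|k IH] kn; first by rewrite Y0.
  have -> : trajectory x t k.+1 = cusped_act (base (trajectory x t k)) (t k) by [].
  by rewrite -(IH (ltnW kn)) -(inc k kn) /increments actM mulgV act1.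
split; first by rewrite h.
move=> k kn; rewrite /increments (h k (ltnW kn)) (h k.+1 kn).
have -> : trajectory x t k.+1 = cusped_act (base (trajectory x t k)) (t k) by [].
by rewrite actM mulVg act1.
Qed.

Lemma measurable_increments : measurable_fun setT increments.
Proof.
have [mY _] := PY; have [code code_inj] := cusped_code.
apply: (@measurability _ _ Omega (seqsp (increment G l)) setT increments (@cylinders _)) => //.
move=> _ [_ [->|[n [t ->]]] <-]; first by rewrite preimage_set0 setI0.
rewrite setTI (_ : _ @^-1` _ = \bigcup_(x in [set: X])
    [set w | forall k, (k <= n)%N -> Y k w = trajectory x t k]).
  apply: countable_bigcupT_measurable.
    by apply/countable_injP; exists code => u v _ _; exact: code_inj.
  move=> x; rewrite (_ : [set w | _] = \bigcap_(k in [set k | (k <= n)%N])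
      (Y k @^-1` [set trajectory x t k])).
    by apply: bigcap_measurableType => k _; exact: mY.
  by apply/seteqP; split=> w /= h k kn; exact: h.
apply/seteqP; split=> [w /= h|w [x _ /= /increments_cyl[]//]].
by exists (Y 0%N w) => //=; apply/increments_cyl.
Qed.

HB.instance Definition _ := isMeasurableFun.Build _ _ _ _ increments measurable_increments.

(** Under P x the process starts at x almost surely, and then prescribing n increments amounts to
    prescribing the path up to time n, whose probability is given by [markov_process]. The resulting
    law does not depend on x. *)
Lemma increments_law x : bernoulli_law step_law (distribution (P x) increments).
Proof.
have [mY PYx] := PY; move=> n t.
have mpre : measurable (increments @^-1` cyl n t).
  by rewrite -[X in measurable X]setTI; apply: measurable_increments => //; exact: measurable_cyl.
have mY0 : measurable (Y 0%N @^-1` [set x]) by exact: mY.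
transitivity (P x (increments @^-1` cyl n t)) => //.
have Y0x : P x (Y 0%N @^-1` [set x]) = 1%E.
  have := PYx x 0%N (fun=> x); rewrite big_ord0 eqxx mulr1 => <-.
  congr (P x _); apply/seteqP; split=> w /=; first by move=> Y0 [|k].
  by move=> h; exact: h.
have Y0C : P x (~` (Y 0%N @^-1` [set x])) = 0%E by rewrite probability_setC// Y0x subee.
have -> : P x (increments @^-1` cyl n t) =
    P x [set w | forall k, (k <= n)%N -> Y k w = trajectory x t k].
  rewrite (_ : [set w | _] = (increments @^-1` cyl n t) `&` (Y 0%N @^-1` [set x])); last first.
    apply/seteqP; split=> [w /= /increments_cyl[]//|w /= [h h0]].
    by apply/increments_cyl.
  apply/eqP; rewrite eq_le; apply/andP; split; last first.
    by apply: le_measure; rewrite ?inE//; exact: measurableI.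
  set I := _ `&` _.
  have : (P x (I `|` ~` (Y 0%N @^-1` [set x])) <= P x I + P x (~` (Y 0%N @^-1` [set x])))%E.
    by apply: measureU2; [exact: measurableI|exact: measurableC].
  rewrite Y0C adde0; apply: le_trans; apply: le_measure; rewrite ?inE//.
    by apply: measurableU; [exact: measurableI|exact: measurableC].
  by move=> w hw; have [h|h] := pselect (Y 0%N w = x); [left|right].
rewrite PYx eqxx mul1r; congr _%:E; apply: eq_bigr => k _ /=.
by rewrite /step_law /kernel base_act mulKg /mass level_act /= invg1 mul1g.
Qed.

(** Nullity under the weighted sum [law_m] is checked at each starting point, with one and the same
    exceptional set. *)
Lemma law_increments (B : set (seqsp (increment G l))) : measurable B ->
  (forall Q : probability (seqsp (increment G l)) R, bernoulli_law step_law Q -> Q B = 0%E) ->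
  law_m mass P (increments @^-1` B) = 0%E.
Proof.
move=> mB QB; rewrite /law_m esum1// => x _.
suff -> : P x (increments @^-1` B) = 0%E by rewrite mule0.
exact: QB (increments_law x).
Qed.

End Trajectories.

(** * Comparison of the chain with the group walk *)

Lemma rho_G_walk : exists C, forall x y,
  `|rho_G kernel mass x y - - ln (walk_green ((base x)^-1 * base y)%g / green_scale)| <= C.
Proof.
have gs := green_scale_gt0; have om := origin_mass_gt0.
pose c0 : R := inf (green_constants kernel mass).
(* Nonemptiness of the set of constants matters: otherwise the infimum would be a default value. *)
have c1 : 1 <= c0.
  by apply: lb_le_inf; [case: kernel_has_green_metric|move=> c []].
have c0_gt0 : 0 < c0 by exact: lt_le_trans c1.
have cm : 0 < c0 * origin_mass by exact: mulr_gt0.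
exists (`|ln (walk_green 1%g / green_scale)| +
  (`|ln (c0 * origin_mass)| + `|ln green_scale|)) => x y.
(* On the diagonal [rho_G] is 0 by convention while the walk expression is a fixed constant, which
   the first summand of C covers. Elsewhere the mass of y cancels and only the ratio of the two
   normalizations remains. *)
rewrite /rho_G; case: eqVneq => [->|xy].
  by rewrite mulVg sub0r opprK lerDl addr_ge0.
set g := (_ * _)%g; have my := mass_gt0 y; have wg := walk_green_gt0 g.
have -> : green_fin kernel x y / (c0 * mass y) = walk_green g / (c0 * origin_mass).
  by rewrite green_fin_chain// -/g; field; rewrite !gt_eqF.
rewrite (@ln_div _ _ (c0 * origin_mass)) // (@ln_div _ _ green_scale) //.
rewrite (_ : _ - _ = ln (c0 * origin_mass) - ln green_scale); last by ring.
by apply: le_trans (ler_normB _ _) _; rewrite lerDr.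
Qed.

(** Here the mass of the endpoint does not cancel, and its logarithm contributes -(ln 4) times the
    height, up to a constant. The shift to n.+1 avoids time zero, where the factorization fails. *)
Lemma nstep_walk_log : exists C C', forall n x y,
  `|- ln (fine (nstep kernel n.+1 x y)) - - ln (walk_prob n.+1 ((base x)^-1 * base y)%g)|
    <= C + C' * (height (level y))%:R.
Proof.
have om := origin_mass_gt0.
exists (`|ln weight_mass| + `|ln origin_mass|), (ln 4) => n x y.
have my := mass_gt0 y; have wp := walk_prob_gt0 n ((base x)^-1 * base y)%g.
have mo : 0 < mass y / origin_mass by exact: divr_gt0.
rewrite nstep_chain (lnM wp mo) (ln_div my om).
have -> : ln (mass y) = - (ln 4 * (height (level y))%:R) - ln weight_mass.
  rewrite /mass /weight ln_div ?posrE ?raw_weight_gt0 ?weight_mass_gt0//.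
  by rewrite /raw_weight lnXn ?invr_gt0// lnV ?posrE// mulNrn mulr_natr.
set k := (height _)%:R; set w := ln (walk_prob _ _).
have -> : - (w + (- (ln 4 * k) - ln weight_mass - ln origin_mass)) - - w =
  ln 4 * k + (ln weight_mass + ln origin_mass) by ring.
apply: le_trans (ler_normD _ _) _; rewrite addrC.
have ln4 : 0 <= ln (4 : R) by rewrite ln_ge0// ler1n.
by rewrite [X in _ + X <= _]ger0_norm ?mulr_ge0// lerD2r; exact: ler_normD.
Qed.

Section ChainLimits.
Variables (H : 'I_l -> set G) (a : R).
Hypothesis H_subgroup : forall i, is_subgroup (H i).
Hypothesis a1 : 1 < a.

Lemma chain_limits : exists lX lG h : R,
  forall (d : measure_display) (Omega : measurableType d)
    (P : X -> probability Omega R) (Y : nat -> Omega -> X),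
  markov_process kernel P Y ->
  {ae law_m mass P, forall w : Omega,
    [/\ rho_X H [set` s] a (Y 0%N w) (Y n w) / n%:R @[n --> \oo] --> lX,
        rho_G kernel mass (Y 0%N w) (Y n w) / n%:R @[n --> \oo] --> lG
      & - ln (fine (nstep kernel n (Y 0%N w) (Y n w))) / n%:R @[n --> \oo] --> h]}.
Proof.
have [lX [BX [mBX QX limX]]] := drift_limit H_subgroup a1.
have [lG [BG [mBG QG limG]]] := green_limit.
have [h [Bh [mBh Qh limh]]] := entropy_limit.
have [Bd [mBd Qd limd]] := height_limit.
exists lX, lG, h => d Omega P Y PY.
exists (increments Y @^-1` (BX `|` BG `|` (Bh `|` Bd))); split.
- rewrite -[X in measurable X]setTI; apply: (measurable_increments PY) => //.
  by do !apply: measurableU.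
- apply: (law_increments PY); first by do !apply: measurableU.
  move=> Q Qlaw.
  have QU A B : measurable A -> measurable B -> Q A = 0%E -> Q B = 0%E -> Q (A `|` B) = 0%E.
    by move=> mA mB QA QB; transitivity (Q A) => //; exact: measureU0.
  by apply: (QU); [exact: measurableU|exact: measurableU|apply: QU; auto|apply: QU; auto].
apply: subsetCl => w /= /not_orP[/not_orP[nX nG] /not_orP[nh nd]].
have hd := limd _ nd.
split.
(* The initial depth is constant along the trajectory, and the depth of the vertex at time n + 1 is
   at most the height of its level. *)
- apply: (@cvg_squeeze_height _ _ _ _ (depth (level (Y 0%N w)))%:R 1 (limX _ nX) hd) => n.
  rewrite position_increments level_increments mul1r.
  apply: le_trans (rho_base H_subgroup a1 sV sG (Y 0%N w) (Y n.+1 w)) _.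
  by rewrite lerD2l ler_nat leq_addl.
- have [C rhoC] := rho_G_walk.
  apply: (@cvg_squeeze_height _ _ _ _ C 0 (limG _ nG) hd) => n.
  by rewrite position_increments mul0r addr0.
have [C [C' entC]] := nstep_walk_log.
apply: (@cvg_squeeze_height _ _ _ _ C C' (limh _ nh) hd) => n.
by rewrite position_increments level_increments.
Qed.

End ChainLimits.

End Chain.

Theorem theorem0p2 (R : realType) (Gamma : groupType) (l : nat)
  (H : 'I_l -> set Gamma)
  (Gamma_fg : finitely_generated [set: Gamma])
  (H_subgroup : forall i, is_subgroup (H i))
  (H_fg : forall i, finitely_generated (H i))
  (H_infinite : forall i, infinite_set (H i))
  (H_vnil : forall i, virtually_nilpotent (H i))
  (Gamma_hyp : relatively_hyperbolic R H)
  (Gamma_nonelem : non_elementary H)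
  (S : set Gamma) (a : R) (Sa : cusped_data H S a) :
  exists (p : cusped Gamma l -> cusped Gamma l -> R) (m : cusped Gamma l -> R),
    [/\ reversible_chain p m (@cusped_act Gamma l),
        has_green_metric p m
      & exists lX lG h : R,
        forall (d : measure_display) (Omega : measurableType d)
          (P : cusped Gamma l -> probability Omega R)
          (Y : nat -> Omega -> cusped Gamma l),
        markov_process p P Y ->
        {ae law_m m P, forall w : Omega,
          [/\ rho_X H S a (Y 0%N w) (Y n w) / n%:R @[n --> \oo] --> lX,
              rho_G p m (Y 0%N w) (Y n w) / n%:R @[n --> \oo] --> lG
            & - ln (fine (nstep p n (Y 0%N w) (Y n w))) / n%:R
                @[n --> \oo] --> h]}].
Proof.
have [S_finite S_sym S_gen _ a1] := Sa.
have /finite_seqP[s Ss] := S_finite; rewrite {}Ss {S_finite Sa} in S_sym S_gen *.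
have [D D0 growth] := not_virtually_cyclic_growth S_sym S_gen Gamma_nonelem.1.
exists (kernel R s D), (@mass R Gamma l); split.
- exact: kernel_reversible.
- exact: kernel_has_green_metric.
exact: chain_limits.
Qed.
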